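(* Let $\mathcal{J}$ be an $r$-partite $k$-chain with vertex sets $E_1,\dots,E_r$ and let $0<\epsilon\le|\mathcal{J}|^{-1}$. Let $X_1,\dots,X_r$ be a sequence of (disjoint) finite sets and for each subset $A\subset[r]$ of size at most $k$ let $\mathcal{P}(A)$ be a partition of the hypergraph $K(A)$ into $n_A$ sets. Then there are refinements $\mathcal{Q}(A)$ of the partitions $\mathcal{P}(A)$, leading to a chain decomposition $\{\mathcal{H}(x):x\in X_1\times\dots\times X_r\}$ of $\mathcal{K}_k(X_1,\dots,X_r)$, with the following property: if $x=(x_1,\dots,x_r)$ is a randomly chosen element of $X_1\times\dots\times X_r$ (uniformly), then the probability that the chain $\mathcal{H}(x)$ is $(\epsilon,\mathcal{J},k)$-quasirandom is at least $1-\epsilon$. Moreover, $\mathcal{Q}(A)=\mathcal{P}(A)$ when $|A|=k$, and for general $A$ the number $m_A$ of sets in the partition $\mathcal{Q}(A)$ is bounded above by a quantity depending only on $\epsilon$, $\mathcal{J}$, $k$ and the numbers $n_C$ ($C\subset[r]$, $|C|\le k$).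
   Context: All sets are finite, $[r]=\{1,\dots,r\}$, $\subset$ allows equality, and $\mathbb{E}$ denotes the uniform average. Chains. An $r$-partite hypergraph with (disjoint) vertex sets $X_1,\dots,X_r$ is a collection of subsets $A$ (edges) of $X_1\cup\dots\cup X_r$ with $|A\cap X_i|\le1$ for all $i$. It is an $r$-partite chain if every subset of an edge is an edge; it is a $k$-chain if in addition the largest size of an edge is $k$. $|\mathcal{J}|$ is the number of edges of $\mathcal J$. The index $i(A)$ of a set $A$ that is an edge of an $r$-partite hypergraph (or, more generally, meets each vertex set at most once) is the set of $i$ such that $A$ meets the $i$-th vertex set; a subset $A\subset[r]$ is regarded as having index $A$. Relative densities. Let $\mathcal{H}$ be an $r$-partite chain with vertex sets $X_1,\dots,X_r$. For a set $A$ with index $i(A)\subset[r]$ and $|A|=|i(A)|$, $H(A)$ is the collection of all $E\in\mathcal{H}$ with $i(E)=i(A)$, and $H_*(A)$ is the collection of all sets $D\subset X_1\cup\dots\cup X_r$ of index $i(A)$ (meeting each $X_i$, $i\in i(A)$, in exactly one point and no other $X_i$) all of whose subsets of size $|A|-1$ (equivalently, all of whose proper subsets) belong to $\mathcal{H}$. The relative density is $\delta_A=|H(A)|/|H_*(A)|$. Octahedral quasirandomness. If $i(A)=\{i_1,\dots,i_s\}$ and $f$ is a real function on $X_{i_1}\times\dots\times X_{i_s}$, then $\mathrm{Oct}(f)=\mathbb{E}_{x_1^0,x_1^1\in X_{i_1}}\cdots\mathbb{E}_{x_s^0,x_s^1\in X_{i_s}}\prod_{\varepsilon\in\{0,1\}^s}f(x_1^{\varepsilon_1},\dots,x_s^{\varepsilon_s})$.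 Let $f^A$ be the function that equals $1-\delta_A$ at tuples whose underlying set lies in $H(A)$, $-\delta_A$ at tuples whose underlying set lies in $H_*(A)\setminus H(A)$, and $0$ elsewhere. $H(A)$ is $\eta$-quasirandom relative to $\mathcal{H}$ if $\mathrm{Oct}(f^A)\le\eta\prod_{C\subset A}\delta_C^{2^{|C|}}$, the product being over all subsets $C$ of $A$, including $A$ itself. Quasirandom chains. Let $\mathcal{J}$ be an $r$-partite chain and $\mathcal{H}$ an $r$-partite chain; for $A\in\mathcal{J}$ let $\delta_A$ be the relative density of $H(A)$ in $\mathcal{H}$. Define $\epsilon_k=\epsilon$ and, for $1\le j\le k-1$, $\epsilon_{k-j}=2^{-jk-1}|\mathcal{J}|^{-1}\bigl(\epsilon_{k-j+1}\prod_{A\in\mathcal{J},|A|\ge k-j+1}\delta_A\bigr)^{2^{jk}}$; and for $0\le j\le k-1$, $\eta_{k-j}=\frac12\bigl(\epsilon_{k-j}\prod_{A\in\mathcal{J},|A|\ge k-j}\delta_A\bigr)^{2^{k(j+1)}}$. $\mathcal{H}$ is $(\epsilon,\mathcal{J},k)$-quasirandom if for every nonempty $A\in\mathcal{J}$ of size $j\le k$, $H(A)$ is $\eta_j$-quasirandom relative to $\mathcal{H}$. Partitions and chain decompositions. For $A\subset[r]$, $K(A)$ is the collection of all subsets of $X_1\cup\dots\cup X_r$ that meet $X_i$ in a single point if $i\in A$ and are disjoint from $X_i$ otherwise; $\mathcal{K}_k(X_1,\dots,X_r)$ is the union of all $K(A)$ with $|A|\le k$. Suppose that a partition of $K(A)$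 is given for every $A\subset[r]$ with $|A|\le k$. Two sets $B,B'\in K(A)$ are $C$-equivalent, for $C\subset A$, if the unique subsets $D\subset B$, $D'\subset B'$ of index $C$ lie in the same cell of the partition of $K(C)$; they are strongly equivalent if they are $C$-equivalent for every $C\subset A$. For $x=(x_1,\dots,x_r)\in X_1\times\dots\times X_r$ let $x(A)=\{x_i:i\in A\}$, let $H(A,x)$ be the collection of all $B\in K(A)$ strongly equivalent to $x(A)$, and let $\mathcal{H}(x)=\bigcup_{|A|\le k}H(A,x)$; this is an $r$-partite $k$-chain. In the theorem $\mathcal{H}(x)$ is formed from the partitions $\mathcal{Q}(A)$. A chain decomposition of $\mathcal{K}_k(X_1,\dots,X_r)$ is a set of $r$-partite $k$-chains with vertex sets $X_1,\dots,X_r$ such that (i) for any two of them, $\mathcal{H}$ and $\mathcal{H}'$, and any $A\subset[r]$ with $|A|\le k$, $H(A)$ and $H'(A)$ are equal or disjoint, and (ii) for every $(x_1,\dots,x_r)\in X_1\times\dots\times X_r$ exactly one of the chains contains every subset of $\{x_1,\dots,x_r\}$ of size at most $k$. The set of chains $\mathcal{H}(x)$ is always a chain decomposition. *)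

(* Defs.v *)
From HB Require Import structures.
From mathcomp Require Import all_boot all_order all_algebra.
From mathcomp Require Import reals.

Set Implicit Arguments.
Unset Strict Implicit.
Unset Printing Implicit Defensive.

Import Order.TTheory GRing.Theory Num.Theory.

Local Open Scope ring_scope.

Definition avg (R : realType) (T : finType) (f : T -> R) : R :=
  (#|T|%:R)^-1 * \sum_(x : T) f x.

Definition uprob (R : realType) (T : finType) (P : pred T) : R :=
  avg (fun x : T => (P x)%:R).

Section Chains.

Variables (r : nat) (X : 'I_r -> finType).

(* The disjoint union of the vertex sets: the vertex x of X_i is Tagged X x. *)
Definition vertex : finType := {i : 'I_r & X i}.

Definition part (i : 'I_r) : {set vertex} := [set v | tag v == i].

Definition is_partite (H : {set {set vertex}}) : Prop :=
  forall A, A \in H -> forall i, (#|A :&: part i| <= 1)%N.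

Definition is_chain (H : {set {set vertex}}) : Prop :=
  is_partite H /\ forall A B : {set vertex}, A \in H -> B \subset A -> B \in H.

Definition is_kchain (k : nat) (H : {set {set vertex}}) : Prop :=
  [/\ is_chain H,
      exists2 A, A \in H & #|A| = k
    & forall A, A \in H -> (#|A| <= k)%N].

Definition idx (B : {set vertex}) : {set 'I_r} := [set tag v | v in B].

Definition K (A : {set 'I_r}) : {set {set vertex}} :=
  [set B | [forall i, #|B :&: part i| == (i \in A)]].

(* Since H(A), H_*(A), delta_A and f^A only depend on the index of A, they are
   defined for A a set of indices. *)
Definition Hidx (H : {set {set vertex}}) (A : {set 'I_r}) : {set {set vertex}} :=
  [set B in H | idx B == A].

(* For A empty the condition on C is vacuous, so that Hstar H set0 = [set set0]. *)
Definition Hstar (H : {set {set vertex}}) (A : {set 'I_r}) :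
    {set {set vertex}} :=
  [set D in K A |
    [forall C : {set vertex},
      (C \subset D) && (#|C|.+1 == #|D|) ==> (C \in H)]].

(* The function i |-> x_i, for i in A, is an element of the product of the
   X_i, i in A. *)
Definition tuple_on (A : {set 'I_r}) : finType :=
  {dffun forall i : {i : 'I_r | i \in A}, X (val i)}.

Definition tuple_set (A : {set 'I_r}) (y : tuple_on A) : {set vertex} :=
  [set Tagged X (y i) | i : {i : 'I_r | i \in A}].

Definition all_tuples : finType := {dffun forall i : 'I_r, X i}.

Definition proj (x : all_tuples) (A : {set 'I_r}) : {set vertex} :=
  [set Tagged X (x i) | i in A].

End Chains.

(* The pair p consists of (x_i^0)_i and (x_i^1)_i. *)
Definition Oct (R : realType) (I : finType) (Y : I -> finType)
    (f : {dffun forall i, Y i} -> R) : R :=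
  avg (fun p : {dffun forall i, Y i} * {dffun forall i, Y i} =>
    \prod_(e : {ffun I -> bool})
      f (finfun (fun i => if e i then p.2 i else p.1 i))).

Section Quasirandomness.

Variables (R : realType) (r : nat) (X : 'I_r -> finType).
Variable (H : {set {set vertex X}}).

Definition reldens (A : {set 'I_r}) : R :=
  #|Hidx H A|%:R / #|Hstar H A|%:R.

Definition balanced (A : {set 'I_r}) (y : tuple_on X A) : R :=
  if tuple_set y \in Hidx H A then 1 - reldens A
  else if tuple_set y \in Hstar H A then - reldens A
  else 0.

Definition rel_quasirandom (eta : R) (A : {set 'I_r}) : bool :=
  Oct (@balanced A) <=
    eta * \prod_(C : {set 'I_r} | C \subset A) reldens C ^+ (2 ^ #|C|).

Variables (E : 'I_r -> finType) (J : {set {set vertex E}}) (k : nat) (eps : R).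

(* The product of delta_A over the edges A of J of size at least m; several
   edges of J may have the same index. *)
Definition dens_prod (m : nat) : R :=
  \prod_(A in J | (m <= #|A|)%N) reldens (idx A).

(* eps_desc j is eps_{k-j}. *)
Fixpoint eps_desc (j : nat) : R :=
  if j is j'.+1 then
    2 ^- (j * k + 1) * #|J|%:R^-1
      * (eps_desc j' * dens_prod (k - j')) ^+ (2 ^ (j * k))
  else eps.

(* eta_desc j is eta_{k-j}. *)
Definition eta_desc (j : nat) : R :=
  2^-1 * (eps_desc j * dens_prod (k - j)) ^+ (2 ^ (k * (j + 1))).

Definition quasirandom : bool :=
  [forall A in J, (A != set0) && (#|A| <= k)%N ==>
     rel_quasirandom (eta_desc (k - #|A|)) (idx A)].

End Quasirandomness.

Section Decompositions.

Variables (r : nat) (X : 'I_r -> finType) (k : nat).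

Definition refines (T : finType) (Q P : {set {set T}}) : Prop :=
  forall S, S \in Q -> exists2 S', S' \in P & S \subset S'.

(* When B is in K A and C is a subset of A, this is the unique subset of B of
   index C. *)
Definition subidx (B : {set vertex X}) (C : {set 'I_r}) : {set vertex X} :=
  [set v in B | tag v \in C].

Variable Q : {set 'I_r} -> {set {set {set vertex X}}}.

Definition C_equiv (C : {set 'I_r}) (B B' : {set vertex X}) : bool :=
  [exists S in Q C, (subidx B C \in S) && (subidx B' C \in S)].

Definition strong_equiv (A : {set 'I_r}) (B B' : {set vertex X}) : bool :=
  [forall C : {set 'I_r}, (C \subset A) ==> C_equiv C B B'].

Definition chain_part (A : {set 'I_r}) (x : all_tuples X) :
    {set {set vertex X}} :=
  [set B in K X A | strong_equiv A B (proj x A)].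

Definition chain_at (x : all_tuples X) : {set {set vertex X}} :=
  \bigcup_(A : {set 'I_r} | (#|A| <= k)%N) chain_part A x.

Definition is_chain_decomposition (D : {set {set {set vertex X}}}) : Prop :=
  [/\ forall H, H \in D -> is_kchain k H,
      forall H H', H \in D -> H' \in D ->
        forall A : {set 'I_r}, (#|A| <= k)%N ->
          Hidx H A = Hidx H' A \/ [disjoint Hidx H A & Hidx H' A]
    & forall x : all_tuples X,
        exists! H, H \in D /\
          forall S : {set vertex X},
            S \subset proj x [set: 'I_r] -> (#|S| <= k)%N -> S \in H].

End Decompositions.

(* Main.v *)
Require Import Defs.
From mathcomp Require Import all_boot all_order all_algebra.
From mathcomp Require Import boolp reals.
From mathcomp Require Import ring lra zify.

(** Encode the partition of K(A) as a colouring q A of the tuples x that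
    depends only on the coordinates in A. Two tuples lie over the same cell of
    H_*(A) when they have the same colours at all proper subsets of A, and the
    relative density of H(A) at x is the conditional expectation, given these
    colours, of the indicator g of the colour q A x.

    The partitions are refined by a strong regularity lemma
    (strong_regularity). Its outcome is that, for each A and each colour,
    g = (conditional expectation) + err + unf, where err is small in mean
    square in terms of the number of colours used at level |A| and above, and
    unf correlates by at most theta with products of functions of proper
    subsets of the coordinates, theta being as small as desired in terms of the
    total number of colours. The levels are treated from the top. For level j
    the lower levels are regularised by induction, then refined so that g minus
    its conditional expectation is uniform, and one stops as soon as this second
    refinement does not increase the mean-square density (the energy) by more
    than a fixed amount; the difference of the two conditional expectations is
    err. The energy is bounded, so the number of rounds is too. Level k is never
    refined, and the bound on the number of colours does not involve the vertex
    sets.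

    Most points x are good (good_at_mostly): every relative density at x is
    bounded below in terms of the number of colours of its level, because cells
    of small relative density cover few points, and err has a small conditional
    mean square at x by Markov's inequality.

    At a good point one wants Oct(f^A) to be small compared with the product of
    the densities of all faces of an octahedron. It suffices to decompose one of
    the factors f^A (oct_cell_le). The structured part is cancelled by the
    subtraction of delta_A. The part unf is handled by freezing all coordinates
    outside one corner: every other factor then depends on a proper subset of
    the coordinates of that corner. The part err is not small compared with the
    densities of the lower levels, so it needs relative control: one application
    of the Cauchy-Schwarz inequality (error_term_le) leaves the number of pairs
    of octahedra sharing a corner, and this must be at most a constant times its
    expected value. That is the upper counting lemma count_hits_le, proved for
    arbitrary configurations by induction on the size of the edges: the edges of
    largest size are removed one by one, the error of each removal being bounded
    by the same Cauchy-Schwarz argument through the count of a doubled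
    configuration with smaller edges.

    Finally the thresholds eta_j of the definition of a quasirandom chain are
    bounded below (eta_desc_ge) in terms of the lower bound for the densities of
    the edges of size at least j, so that the regularity lemma can be applied
    with functions that beat them. *)

Set Implicit Arguments.
Unset Strict Implicit.
Unset Printing Implicit Defensive.

Import Order.TTheory GRing.Theory Num.Theory.

Local Open Scope ring_scope.

(** * Uniform averages and conditional expectations *)

Section Averages.

Variable R : realType.
Implicit Types S T : finType.

Lemma eq_avg T (f g : T -> R) : f =1 g -> avg f = avg g.
Proof. by move=> fg; rewrite /avg; congr (_ * _); apply: eq_bigr => x _. Qed.

Lemma avg_le T (f g : T -> R) : (forall x, f x <= g x) -> avg f <= avg g.
Proof.
move=> fg; rewrite /avg ler_wpM2l ?invr_ge0 ?ler0n //.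
by apply: ler_sum => x _.
Qed.

Lemma avg_ge0 T (f : T -> R) : (forall x, 0 <= f x) -> 0 <= avg f.
Proof.
move=> f0; rewrite /avg mulr_ge0 ?invr_ge0 ?ler0n //.
by apply: sumr_ge0 => x _.
Qed.

Lemma avgD T (f g : T -> R) : avg (fun x => f x + g x) = avg f + avg g.
Proof. by rewrite /avg big_split mulrDr. Qed.

Lemma avgZ T (c : R) (f : T -> R) : avg (fun x => c * f x) = c * avg f.
Proof. by rewrite /avg -mulr_sumr mulrCA. Qed.

Lemma avgN T (f : T -> R) : avg (fun x => - f x) = - avg f.
Proof. by rewrite /avg sumrN mulrN. Qed.

Lemma avgB T (f g : T -> R) : avg (fun x => f x - g x) = avg f - avg g.
Proof. by rewrite avgD avgN. Qed.

Lemma avg_sum T (I : Type) (s : seq I) (P : pred I) (F : I -> T -> R) :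
  avg (fun x => \sum_(i <- s | P i) F i x) = \sum_(i <- s | P i) avg (F i).
Proof. by rewrite /avg exchange_big /= mulr_sumr. Qed.

Lemma avg_const T (c : R) : (0 < #|T|)%N -> avg (fun _ : T => c) = c.
Proof.
move=> T0; rewrite /avg sumr_const -[c *+ _]mulr_natl mulrA mulVf ?mul1r //.
by rewrite pnatr_eq0 -lt0n.
Qed.

Lemma avg_le_const T (f : T -> R) (c : R) :
  0 <= c -> (forall x, f x <= c) -> avg f <= c.
Proof.
move=> c0 fc; case: (posnP #|T|) => [T0|T0].
  by rewrite /avg T0 invr0 mul0r.
by rewrite -[leRHS](avg_const c T0); apply: avg_le.
Qed.

Lemma ler_norm_avg T (f : T -> R) : `|avg f| <= avg (fun x => `|f x|).
Proof.
rewrite /avg normrM ger0_norm ?invr_ge0 ?ler0n //.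
by rewrite ler_wpM2l ?invr_ge0 ?ler0n // ler_norm_sum.
Qed.

Lemma avg_pair S T (F : S * T -> R) :
  avg F = avg (fun x => avg (fun y => F (x, y))).
Proof.
rewrite /avg card_prod natrM invfM -mulr_sumr mulrA; congr (_ * _).
by rewrite pair_bigA /=; apply: eq_bigr => -[x y].
Qed.

Lemma avg_exchange S T (F : S -> T -> R) :
  avg (fun x => avg (F x)) = avg (fun y => avg (fun x => F x y)).
Proof.
rewrite /avg -!mulr_sumr mulrCA exchange_big /=; congr (_ * (_ * _)).
Qed.

Lemma avg_bij S T (h : S -> T) (F : T -> R) :
  bijective h -> avg F = avg (fun x => F (h x)).
Proof.
move=> bh; rewrite /avg (bij_eq_card bh); congr (_ * _).
by rewrite (reindex h) //; apply: onW_bij.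
Qed.

(** Both components of a measure-preserving involution of a product space are
    measure-preserving maps onto the factors; most changes of variables below
    are of this kind, the involution exchanging some coordinates of the two
    points. *)
Lemma avg_swap S T (h : S * T -> S * T) (F : S -> R) :
  (0 < #|T|)%N -> involutive h -> avg (fun p => F (h p).1) = avg F.
Proof.
move=> T0 hK.
rewrite -(avg_bij (fun p => F p.1) (inv_bij hK)) avg_pair.
by apply: eq_avg => x /=; rewrite avg_const.
Qed.

Lemma cauchy_schwarz_avg T (f g : T -> R) :
  avg (fun x => f x * g x) ^+ 2 <=
    avg (fun x => f x ^+ 2) * avg (fun x => g x ^+ 2).
Proof.
have : 0 <= avg (fun x => avg (fun y => (f x * g y - f y * g x) ^+ 2)).
  by apply: avg_ge0 => x; apply: avg_ge0 => y; rewrite sqr_ge0.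
have -> : avg (fun x => avg (fun y => (f x * g y - f y * g x) ^+ 2)) =
    2 * (avg (fun x => f x ^+ 2) * avg (fun x => g x ^+ 2)
         - avg (fun x => f x * g x) ^+ 2).
  transitivity (avg (fun x => f x ^+ 2 * avg (fun y => g y ^+ 2)
      + g x ^+ 2 * avg (fun y => f y ^+ 2)
      - 2 * avg (fun y => f y * g y) * (f x * g x))).
    apply: eq_avg => x.
    transitivity (avg (fun y => f x ^+ 2 * g y ^+ 2 + g x ^+ 2 * f y ^+ 2
        - 2 * (f x * g x) * (f y * g y))).
      by apply: eq_avg => y; ring.
    by rewrite avgB avgD !avgZ; ring.
  rewrite avgB avgD !avgZ.
  have mC (a : R) (h : T -> R) : avg (fun x => h x * a) = a * avg h.
    by rewrite -avgZ; apply: eq_avg => x; rewrite mulrC.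
  by rewrite !mC; ring.
by rewrite pmulr_rge0 // subr_ge0.
Qed.

Lemma markov_avg T (f : T -> R) (t : R) :
  0 < t -> (forall x, 0 <= f x) ->
  avg (fun x => (t < f x)%R%:R) <= avg f / t.
Proof.
move=> t0 f0; rewrite ler_pdivlMr // mulrC -avgZ; apply: avg_le => x.
by case: ltP => [/ltW|_]; rewrite ?mulr1 ?mulr0.
Qed.

End Averages.

Section ConditionalExpectation.

Variables (R : realType) (T : finType) (K : eqType).
Implicit Types (key : T -> K) (f g h : T -> R).

(** The conditional expectation of g with respect to the partition of T into
    the fibres of key. *)
Definition cexp key g (x : T) : R :=
  (\sum_(y | key y == key x) g y) / #|[pred y | key y == key x]|%:R.

Lemma fibre_gt0 key x : 0 < (#|[pred y | key y == key x]|%:R : R).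
Proof. by rewrite ltr0n; apply/card_gt0P; exists x; rewrite inE. Qed.

Lemma cexp_key key g x y : key x = key y -> cexp key g x = cexp key g y.
Proof. by rewrite /cexp => ->. Qed.

Lemma cexp_ge0 key g x : (forall y, 0 <= g y) -> 0 <= cexp key g x.
Proof. by move=> g0; rewrite divr_ge0 ?ler0n // sumr_ge0. Qed.

Lemma cexp_le1 key g x : (forall y, g y <= 1) -> cexp key g x <= 1.
Proof.
move=> g1; rewrite ler_pdivrMr ?fibre_gt0 // mul1r -sumr_const.
by apply: ler_sum => y.
Qed.

Lemma cexp_id key g x :
  (forall y, key y = key x -> g y = g x) -> cexp key g x = g x.
Proof.
move=> gx; rewrite /cexp (eq_bigr (fun=> g x)); last by move=> y /eqP /gx.
rewrite sumr_const -[g x *+ _]mulr_natr mulfK //.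
exact: lt0r_neq0 (fibre_gt0 _ _).
Qed.

Lemma avg_cexp key g h :
  (forall x y, key x = key y -> h x = h y) ->
  avg (fun x => h x * cexp key g x) = avg (fun x => h x * g x).
Proof.
move=> hk; rewrite /avg; congr (_ * _).
under eq_bigr => x _ do rewrite /cexp mulr_suml mulr_sumr.
rewrite (exchange_big_dep predT) //=; apply: eq_bigr => y _.
rewrite (eq_bigr (fun=> h y * g y / #|[pred z | key z == key y]|%:R)); last first.
  by move=> x /eqP kyx; rewrite -kyx (hk _ _ (esym kyx)) mulrA.
rewrite (eq_bigl (fun x => x \in [pred z | key z == key y])); last first.
  by move=> x; rewrite inE eq_sym.
rewrite sumr_const -[_ *+ _]mulr_natr divfK //.
exact: lt0r_neq0 (fibre_gt0 _ _).
Qed.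

Lemma avg_cexp1 key g : avg (cexp key g) = avg g.
Proof.
rewrite (eq_avg (g := fun x => 1 * cexp key g x)); last first.
  by move=> x; rewrite mul1r.
by rewrite avg_cexp //; apply: eq_avg => x; rewrite mul1r.
Qed.

(** Integrating over the fibre of x trades a conditional expectation at the
    point x for its value times the measure of the fibre. *)
Lemma avg_fibre key g x :
  avg (fun z => (key z == key x)%:R * g z) =
    cexp key g x * avg (fun z => (key z == key x)%:R).
Proof.
rewrite /avg mulrCA; congr (_ * _).
under eq_bigr => z _ do rewrite mulr_natl mulrb.
under [in RHS]eq_bigr => z _ do rewrite mulrb.
by rewrite -!big_mkcond /= sumr_const divfK // lt0r_neq0 ?fibre_gt0.
Qed.

End ConditionalExpectation.

(** Orthogonality of martingale differences. *)
Lemma cexp_pythagoras (R : realType) (T : finType) (K K' : eqType)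
    (key : T -> K) (key' : T -> K') (g : T -> R) :
  (forall x y, key' x = key' y -> key x = key y) ->
  avg (fun x => (cexp key' g x - cexp key g x) ^+ 2) =
  avg (fun x => cexp key' g x ^+ 2) - avg (fun x => cexp key g x ^+ 2).
Proof.
move=> kk.
have E : avg (fun x => cexp key g x * cexp key' g x) =
         avg (fun x => cexp key g x ^+ 2).
  rewrite avg_cexp; last by move=> x y /kk; apply: cexp_key.
  by rewrite -(avg_cexp (key := key)) //; apply: cexp_key.
transitivity (avg (fun x => cexp key' g x ^+ 2 + cexp key g x ^+ 2
    - 2 * (cexp key g x * cexp key' g x))).
  by apply: eq_avg => x; ring.
rewrite avgB avgD avgZ E; ring.
Qed.

(** * Colourings, uniformity and energy *)

Section Colourings.

Variables (r : nat) (X : 'I_r -> finType).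
Implicit Types (A C : {set 'I_r}) (x y : all_tuples X).

Definition depends_on (T : Type) A (f : all_tuples X -> T) : Prop :=
  forall x y, (forall i, i \in A -> x i = y i) -> f x = f y.

Definition adapted (T : Type) (b : {set 'I_r} -> all_tuples X -> T) : Prop :=
  forall A, depends_on A (b A).

Implicit Types (q : {set 'I_r} -> all_tuples X -> nat).

(** The cell of H_*(A) over which a tuple lies. *)
Definition lower_key q A x : {ffun {set 'I_r} -> nat} :=
  [ffun C : {set 'I_r} => if C \proper A then q C x else 0%N].

Lemma lower_keyP q A x y :
  lower_key q A x = lower_key q A y <-> (forall C, C \proper A -> q C x = q C y).
Proof.
split=> [/ffunP e C CA|e]; first by have := e C; rewrite !ffunE CA.
by apply/ffunP => C; rewrite !ffunE; case: ifP => // /e.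
Qed.

Lemma lower_key_eqE q A x y :
  (lower_key q A x == lower_key q A y) =
  [forall (C : {set 'I_r} | C \proper A), q C x == q C y].
Proof.
apply/eqP/forall_inP => [/lower_keyP e C CA|e]; first by rewrite e.
by apply/lower_keyP => C /e /eqP.
Qed.

Lemma depends_on_sub (T : Type) A C (f : all_tuples X -> T) :
  C \subset A -> depends_on C f -> depends_on A f.
Proof. by move=> /subsetP CA fC x y xy; apply: fC => i /CA /xy. Qed.

Lemma lower_key_depends q A : adapted q -> depends_on A (lower_key q A).
Proof.
move=> aq x y xy; apply/lower_keyP => C /proper_sub CA.
by apply: (depends_on_sub CA (aq C)).
Qed.

Definition finer (q' q : {set 'I_r} -> all_tuples X -> nat) : Prop :=
  forall A x y, q' A x = q' A y -> q A x = q A y.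

Lemma finer_lower_key q' q A x y : finer q' q ->
  lower_key q' A x = lower_key q' A y -> lower_key q A x = lower_key q A y.
Proof. by move=> f /lower_keyP e; apply/lower_keyP => C /e /f. Qed.

Lemma finer_trans q1 q2 q3 : finer q1 q2 -> finer q2 q3 -> finer q1 q3.
Proof. by move=> f g A x y /f /g. Qed.

(** The pair of q A x and b A x is coded as one natural number, so that
    splitting at most doubles the number of colours. *)
Definition split_below (j : nat) q (b : {set 'I_r} -> all_tuples X -> bool)
    A x : nat :=
  if (#|A| < j)%N then ((q A x).*2 + b A x)%N else q A x.

Lemma split_below_inj j q b A x y : (#|A| < j)%N ->
  split_below j q b A x = split_below j q b A y ->
  q A x = q A y /\ b A x = b A y.
Proof.
rewrite /split_below => ->.
by case: (b A x); case: (b A y) => //= e; split=> //; lia.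
Qed.

Lemma split_below_finer j q b : finer (split_below j q b) q.
Proof.
move=> A x y; case: (ltnP #|A| j) => Aj; first by case/split_below_inj.
by rewrite /split_below ltnNge Aj.
Qed.

End Colourings.

Section Energy.

Variables (R : realType) (r : nat) (X : 'I_r -> finType).
Implicit Types (A C : {set 'I_r}) (x y : all_tuples X).
Implicit Types (q : {set 'I_r} -> all_tuples X -> nat).

(** Correlation with all products of functions of proper subsets of the
    coordinates in A is small: the hypergraph analogue of a small cut norm.
    This is what refining the lower levels can achieve directly, and what
    bounding averages over configurations requires. *)
Definition uniform_on A (theta : R) (g : all_tuples X -> R) : Prop :=
  forall b : {set 'I_r} -> all_tuples X -> bool, adapted b ->
    `|avg (fun x => g x * [forall (C : {set 'I_r} | C \proper A), b C x]%:R)|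
      <= theta.

Definition colour_ind q A (c : nat) x : R := (q A x == c)%:R.

Lemma colour_ind_ge0 q A c x : 0 <= colour_ind q A c x.
Proof. by rewrite ler0n. Qed.

Lemma colour_ind_le1 q A c x : colour_ind q A c x <= 1.
Proof. by rewrite /colour_ind; case: eqP; rewrite ?ler01. Qed.

Definition local_density q A c : all_tuples X -> R :=
  cexp (lower_key q A) (colour_ind q A c).

Lemma local_density_ge0 q A c x : 0 <= local_density q A c x.
Proof. by apply: cexp_ge0 => y; apply: colour_ind_ge0. Qed.

Lemma local_density_le1 q A c x : local_density q A c x <= 1.
Proof. by apply: cexp_le1 => y; apply: colour_ind_le1. Qed.

Definition energy (j n : nat) q : R :=
  \sum_(A : {set 'I_r} | #|A| == j) \sum_(c < n)
    avg (fun x => local_density q A c x ^+ 2).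

Lemma energy_ge0 j n q : 0 <= energy j n q.
Proof.
apply: sumr_ge0 => A _; apply: sumr_ge0 => c _.
by apply: avg_ge0 => x; apply: sqr_ge0.
Qed.

Lemma energy_le j n q : energy j n q <= (2 ^ r * n)%:R.
Proof.
apply: (@le_trans _ _ (\sum_(A : {set 'I_r} | #|A| == j) n%:R)).
  apply: ler_sum => A _; rewrite -[n in leRHS]card_ord -sumr_const.
  apply: ler_sum => c _; apply: avg_le_const => // x.
  by rewrite expr_le1 ?local_density_ge0 ?local_density_le1.
rewrite sumr_const -[n%:R *+ _]mulr_natl -natrM ler_nat leq_mul2r; apply/orP; right.
rewrite -[r in leqRHS]card_ord -cardsT -card_powerset powersetT cardsT.
exact: max_card.
Qed.

Lemma local_density_gap q' q A c : finer q' q -> q' A = q A ->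
  avg (fun x => (local_density q' A c x - local_density q A c x) ^+ 2) =
  avg (fun x => local_density q' A c x ^+ 2) -
  avg (fun x => local_density q A c x ^+ 2).
Proof.
move=> f qA; rewrite /local_density /colour_ind qA.
by apply: cexp_pythagoras => x y; apply: finer_lower_key.
Qed.

Lemma local_density_gap_le j n q' q A (c : 'I_n) :
  finer q' q -> (forall C, #|C| = j -> q' C = q C) -> #|A| = j ->
  avg (fun x => (local_density q' A c x - local_density q A c x) ^+ 2) <=
  energy j n q' - energy j n q.
Proof.
move=> f qj Aj; rewrite /energy -sumrB.
have gap0 C (d : nat) : #|C| == j -> 0 <=
    avg (fun x => local_density q' C d x ^+ 2) -
    avg (fun x => local_density q C d x ^+ 2).
  move=> /eqP /qj qC; rewrite -local_density_gap //.
  by apply: avg_ge0 => x; apply: sqr_ge0.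
rewrite (bigD1 A) ?Aj //= -sumrB (bigD1 c) //=.
rewrite local_density_gap ?qj // -[leRHS]addrA lerDl.
apply: addr_ge0; first by apply: sumr_ge0 => d _; apply: gap0; rewrite Aj.
by apply: sumr_ge0 => C /andP[Cj _]; rewrite -sumrB; apply: sumr_ge0 => d _;
  apply: gap0.
Qed.

Lemma energy_mono j n q' q :
  finer q' q -> (forall C, #|C| = j -> q' C = q C) ->
  energy j n q <= energy j n q'.
Proof.
move=> f qj; rewrite -subr_ge0 /energy -sumrB; apply: sumr_ge0 => A /eqP Aj.
rewrite -sumrB; apply: sumr_ge0 => c _.
rewrite -local_density_gap ?qj //.
by apply: avg_ge0 => x; apply: sqr_ge0.
Qed.

(** A test function witnessing non-uniformity is constant on the cells after
    the colourings below level j are split along it, so that the conditional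
    expectation moves by at least theta in mean square. *)
Lemma energy_increment j n q A (c : 'I_n) (theta : R)
    (b : {set 'I_r} -> all_tuples X -> bool) :
  0 <= theta -> #|A| = j ->
  theta < `|avg (fun x => (colour_ind q A c x - local_density q A c x) *
             [forall (C : {set 'I_r} | C \proper A), b C x]%:R)| ->
  energy j n q + theta ^+ 2 <= energy j n (split_below j q b).
Proof.
move=> th0 Aj; set q' := split_below j q b.
have q'q : finer q' q by apply: split_below_finer.
have q'j C : #|C| = j -> q' C = q C.
  by move=> Cj; apply: funext => x; rewrite /q' /split_below Cj ltnn.
set B := fun x => [forall (C : {set 'I_r} | C \proper A), b C x]%:R : R.
have Bk x y : lower_key q' A x = lower_key q' A y -> B x = B y.
  move=> /lower_keyP e; rewrite /B; congr (nat_of_bool _)%:R.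
  apply: eq_forallb => C; case CA : (C \proper A) => //=.
  have := e C CA; case/split_below_inj => //.
  by rewrite -Aj proper_card.
have -> : avg (fun x => (colour_ind q A c x - local_density q A c x) * B x) =
    avg (fun x => (local_density q' A c x - local_density q A c x) * B x).
  have -> : (fun x => (colour_ind q A c x - local_density q A c x) * B x) =
    (fun x => B x * colour_ind q A c x - local_density q A c x * B x).
    by apply: funext => x; ring.
  rewrite avgB -(avg_cexp _ Bk) -avgB; apply: eq_avg => x.
  by rewrite /local_density /colour_ind q'j //; ring.
move=> H; rewrite -lerBrDl.
apply: le_trans (local_density_gap_le c q'q q'j Aj).
apply: (@le_trans _ _ (avg (fun x =>
    (local_density q' A c x - local_density q A c x) * B x) ^+ 2)).
  by rewrite -[leRHS]real_normK ?num_real // lerXn2r ?nnegrE // ltW.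
apply: (le_trans (cauchy_schwarz_avg _ _)).
rewrite ler_piMr ?avg_ge0 //; first by move=> x; apply: sqr_ge0.
apply: avg_le_const => // x; rewrite /B.
by rewrite expr_le1 ?ler0n // lern1 leq_b1.
Qed.

End Energy.

(** * Regularity lemmas *)

(** The number of colours reached at an intermediate stage varies with the
    vertex sets within known bounds; this makes the parameter of the next stage
    uniform over these values. *)
Lemma bounded_choice (P : nat -> nat -> Prop) :
  (forall s M M', (M <= M')%N -> P s M -> P s M') ->
  (forall s, exists M, P s M) ->
  forall S, exists M, forall s, (s <= S)%N -> P s M.
Proof.
move=> Pmono Pex; elim=> [|S [M HM]].
  by have [M HM] := Pex 0%N; exists M => s; rewrite leqn0 => /eqP ->.
have [M' HM'] := Pex S.+1; exists (maxn M M') => s.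
rewrite leq_eqVlt ltnS => /orP[/eqP ->|/HM].
  by apply: Pmono HM'; apply: leq_maxr.
by apply: Pmono; apply: leq_maxl.
Qed.

Lemma split_below_adapted r (X : 'I_r -> finType) j
    (q : {set 'I_r} -> all_tuples X -> nat) b :
  adapted q -> adapted b -> adapted (split_below j q b).
Proof.
move=> aq ab A x y xy; rewrite /split_below.
by rewrite (aq A x y) // (ab A x y).
Qed.

Section WeakRegularity.

Variables (R : realType) (r : nat).
Implicit Types (A : {set 'I_r}).

Definition weakly_regular (X : 'I_r -> finType) (j n : nat) (theta : R)
    (q : {set 'I_r} -> all_tuples X -> nat) : Prop :=
  forall A (c : 'I_n), #|A| = j ->
    uniform_on A theta (fun x => colour_ind R q A c x - local_density R q A c x).

(** Each splitting along a witness of non-uniformity uses up theta^2 of the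
    energy; N is the number of splittings that the energy still allows. *)
Lemma weak_regularity_steps (j n N : nat) (theta : R) : 0 < theta ->
  forall m, exists M, forall X (q : {set 'I_r} -> all_tuples X -> nat),
    adapted q -> (forall A x, (q A x < m)%N) ->
    (2 ^ r * n)%:R - N%:R * theta ^+ 2 < energy R j n q ->
  exists q', [/\ adapted q', finer q' q,
    forall A, (j <= #|A|)%N -> q' A = q A,
    forall A x, (q' A x < M)%N & weakly_regular j n theta q'].
Proof.
move=> th0; elim: N => [|N IH] m.
  exists 0%N => X q _ _; rewrite mul0r subr0 => H.
  by have := le_lt_trans (energy_le R j n q) H; rewrite ltxx.
have [M HM] := IH m.*2; exists (maxn m M) => X q aq qm qE.
have [reg|] := pselect (weakly_regular j n theta q).
  exists q; split=> // A x.
  by apply: leq_trans (qm A x) _; apply: leq_maxl.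
move=> /existsNP[A] /existsNP[c] /not_implyP[Aj] /existsNP[b].
move=> /not_implyP[ab] /negP; rewrite -ltNge => bad.
have [|A' x||q' [aq' q'q q'j q'M reg]] := HM X (split_below j q b).
- exact: split_below_adapted.
- by have := qm A' x; rewrite /split_below; case: ifP; case: (b A' x); lia.
- apply: lt_le_trans (energy_increment (ltW th0) Aj bad).
  by move: qE; rewrite -(natr1 N); lra.
exists q'; split=> //.
- apply: (finer_trans q'q); exact: split_below_finer.
- move=> B jB; rewrite q'j //; apply: funext => x.
  by rewrite /split_below ltnNge jB.
- by move=> B x; apply: leq_trans (q'M B x) _; apply: leq_maxr.
Qed.

Lemma weak_regularity (j n m : nat) (theta : R) : 0 < theta ->
  exists M, forall X (q : {set 'I_r} -> all_tuples X -> nat),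
    adapted q -> (forall A x, (q A x < m)%N) ->
  exists q', [/\ adapted q', finer q' q,
    forall A, (j <= #|A|)%N -> q' A = q A,
    forall A x, (q' A x < M)%N & weakly_regular j n theta q'].
Proof.
move=> th0; have th20 : 0 < theta ^+ 2 by apply: exprn_gt0.
pose b : R := (2 ^ r * n)%:R / theta ^+ 2.
have b0 : 0 <= b by rewrite divr_ge0 ?ler0n ?ltW.
have [M HM] := weak_regularity_steps j n (Num.bound b) th0 m.
exists M => X q aq qm; apply: HM => //.
apply: lt_le_trans (energy_ge0 R j n q).
by rewrite subr_lt0 -ltr_pdivrMr //; apply: archi_boundP.
Qed.

End WeakRegularity.

Section StrongRegularity.

Variables (R : realType) (r : nat) (eps theta : nat -> R).
Implicit Types (A : {set 'I_r}).
Hypotheses (eps_gt0 : forall m, 0 < eps m) (theta_gt0 : forall m, 0 < theta m).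

Definition level_regular (X : 'I_r -> finType) (i n : nat) (e t : R)
    (q : {set 'I_r} -> all_tuples X -> nat) : Prop :=
  forall A (c : 'I_n), #|A| = i -> exists err unf : all_tuples X -> R,
    [/\ depends_on A err, depends_on A unf,
        forall x, colour_ind R q A c x = local_density R q A c x + err x + unf x,
        avg (fun x => err x ^+ 2) <= e & uniform_on A t unf].

(** Here ms i bounds the number of colours at the levels from i on. The error
    allowed at level i depends on ms i only, hence is fixed before the levels
    below i are refined, whereas the uniformity is as small as one wishes in
    terms of the final number ms 0 of colours. *)
Definition regularised (j m M : nat) (X : 'I_r -> finType)
    (q q' : {set 'I_r} -> all_tuples X -> nat) (ms : nat -> nat) : Prop :=
  [/\ adapted q', finer q' q & forall A, (j <= #|A|)%N -> q' A = q A] /\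
  [/\ forall i i', (i <= i')%N -> (ms i' <= ms i)%N,
      forall i, (j <= i)%N -> ms i = m,
      (ms 0 <= M)%N,
      forall A x, (q' A x < ms #|A|)%N
    & forall i, (i <= j)%N -> level_regular i (ms i) (eps (ms i)) (theta (ms 0)) q'].

Lemma level0_regular (X : 'I_r -> finType) (n : nat) (e t : R)
    (q : {set 'I_r} -> all_tuples X -> nat) :
  0 <= e -> 0 <= t -> adapted q -> level_regular 0 n e t q.
Proof.
move=> e0 t0 aq A c /cards0_eq A0; exists (fun=> 0), (fun=> 0); split=> //.
- move=> x; rewrite !addr0 /local_density cexp_id // => y _.
  by rewrite /colour_ind (aq A y x) // => i; rewrite A0 inE.
- by apply: avg_le_const => // x; rewrite expr0n.
- move=> b ab; rewrite (eq_avg (g := fun=> 0)); last by move=> x; rewrite mul0r.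
  by rewrite (_ : avg _ = 0) ?normr0 // /avg big1 ?mulr0.
Qed.

Lemma local_density_depends (X : 'I_r -> finType)
    (q : {set 'I_r} -> all_tuples X -> nat) A c :
  adapted q -> depends_on A (local_density R q A c).
Proof.
move=> aq x y xy; apply: cexp_key.
exact: (lower_key_depends aq).
Qed.

Lemma colour_ind_depends (X : 'I_r -> finType)
    (q : {set 'I_r} -> all_tuples X -> nat) A c :
  adapted q -> depends_on A (colour_ind R q A c).
Proof. by move=> aq x y xy; rewrite /colour_ind (aq A x y). Qed.

(** If refining the lower levels enough to become uniform hardly raised the
    energy, then the coarser colouring was already regular: the conditional
    expectations on the two refinements differ by the mean-square error. *)
Lemma level_regular_of_energy (X : 'I_r -> finType) (j n : nat) (e t : R)
    (q w : {set 'I_r} -> all_tuples X -> nat) :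
  adapted q -> adapted w -> finer w q -> (forall A, #|A| = j -> w A = q A) ->
  weakly_regular j n t w -> energy R j n w <= energy R j n q + e ->
  level_regular j n e t q.
Proof.
move=> aq aw wq wj wreg wE A c Aj.
exists (fun x => local_density R w A c x - local_density R q A c x).
exists (fun x => colour_ind R w A c x - local_density R w A c x).
split.
- move=> x y xy; have := local_density_depends c aq xy.
  by have := local_density_depends c aw xy => -> ->.
- move=> x y xy; have := local_density_depends c aw xy.
  by have := colour_ind_depends c aw xy => -> ->.
- by move=> x; rewrite /colour_ind wj //; ring.
- apply: (le_trans (local_density_gap_le R c wq wj Aj)).
  by rewrite lerBlDl.
- exact: wreg.
Qed.

Definition regularisable (j : nat) : Prop :=
  forall m, exists M, forall X (q : {set 'I_r} -> all_tuples X -> nat),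
    adapted q -> (forall A x, (q A x < m)%N) ->
  exists q' ms, regularised j m M q q' ms.

(** One round regularises the levels up to j, giving q1, then refines q1 to a
    colouring w that is uniform at level j + 1 relative to the number of colours
    of q1. If the energy has hardly moved between q1 and w, then q1 is as
    desired; otherwise the next round starts from w, and N counts the rounds
    that the energy still allows. *)
Lemma regularisable_steps (j N : nat) : regularisable j ->
  forall m0 m, (m0 <= m)%N ->
  exists M, forall X (q : {set 'I_r} -> all_tuples X -> nat),
    adapted q -> (forall A x, (q A x < m)%N) ->
    (forall A x, (j.+1 <= #|A|)%N -> (q A x < m0)%N) ->
    (2 ^ r * m0)%:R - N%:R * eps m0 < energy R j.+1 m0 q ->
  exists q' ms, regularised j.+1 m0 M q q' ms.
Proof.
move=> regj; elim: N => [|N IH] m0 m m0m.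
  exists 0%N => X q _ _ _; rewrite mul0r subr0 => H.
  by have := le_lt_trans (energy_le R j.+1 m0 q) H; rewrite ltxx.
have [M1 HM1] := regj m.
pose WR s M := forall X (q : {set 'I_r} -> all_tuples X -> nat),
    adapted q -> (forall A x, (q A x < M1)%N) ->
  exists q', [/\ adapted q', finer q' q,
    forall A, (j.+1 <= #|A|)%N -> q' A = q A,
    forall A x, (q' A x < M)%N & weakly_regular j.+1 m0 (theta s) q'].
have [M2 HM2] : exists M, forall s, (s <= M1)%N -> WR s M.
  apply: bounded_choice => [s M M' MM' H X q aq qM1|s].
    have [q' [a1 a2 a3 a4 a5]] := H X q aq qM1; exists q'; split=> // A x.
    exact: leq_trans (a4 A x) MM'.
  exact: weak_regularity.
have [M3 HM3] := IH m0 (maxn m0 M2) (leq_maxl _ _).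
exists (maxn M1 M3) => X q aq qm qm0 qE.
have [q1 [ms [[aq1 q1q q1j] [msm msj ms0 q1ms reg1]]]] := HM1 X q aq qm.
have q1M A x : (q1 A x < M1)%N.
  by apply: leq_trans (q1ms A x) _; apply: leq_trans ms0; apply: msm.
have [w [aw wq1 wj wM wreg]] := HM2 (ms 0%N) ms0 X q1 aq1 q1M.
have q1E : energy R j.+1 m0 q <= energy R j.+1 m0 q1.
  by apply: energy_mono => // A Aj; apply: q1j; rewrite Aj.
have [wE|wE] := leP (energy R j.+1 m0 w) (energy R j.+1 m0 q1 + eps m0).
  exists q1, (fun i => if (i <= j)%N then ms i else m0); split.
    by split=> // A jA; apply: q1j; apply: ltnW.
  split.
  - move=> i i' ii'; case: (leqP i j) => ij; case: (leqP i' j) => i'j //.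
    + exact: msm.
    + by apply: (leq_trans m0m); rewrite -(msj j) //; apply: msm.
    + by lia.
  - by move=> i; rewrite ltnNge => /negbTE ->.
  - by rewrite leq0n; apply: leq_trans ms0 (leq_maxl _ _).
  - move=> A x; case: (leqP #|A| j) => jA; first exact: q1ms.
    by rewrite q1j ?qm0 // ltnW.
  - move=> i; rewrite leq_eqVlt ltnS => /orP[/eqP ->|ij]; last first.
      by rewrite ij leq0n; apply: reg1.
    rewrite ltnn leq0n; apply: (level_regular_of_energy aq1 aw wq1) wE => //.
    by move=> A Aj; apply: wj; rewrite Aj.
have [|A x jA||q' [ms' [[aq' q'w q'j] [m1 m2 m3 m4 m5]]]] := HM3 X w aw.
- by move=> A x; apply: leq_trans (wM A x) (leq_maxr _ _).
- by rewrite wj // q1j ?qm0 // ltnW.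
- by move: qE; rewrite -(natr1 N); lra.
exists q', ms'; split; last first.
  by split=> //; apply: leq_trans m3 (leq_maxr _ _).
split=> //.
- by apply: (finer_trans q'w); apply: (finer_trans wq1).
- by move=> A jA; rewrite q'j // wj // q1j // ltnW.
Qed.

Lemma strong_regularity (j : nat) : regularisable j.
Proof.
elim: j => [|j IH] m.
  exists m => X q aq qm; exists q, (fun=> m); split=> //; split=> // i.
  rewrite leqn0 => /eqP ->.
  by apply: level0_regular => //; apply: ltW.
pose b : R := (2 ^ r * m)%:R / eps m.
have b0 : 0 <= b by rewrite divr_ge0 ?ler0n ?ltW.
have [M HM] := regularisable_steps (Num.bound b) IH (leqnn m).
exists M => X q aq qm; apply: HM => //.
apply: lt_le_trans (energy_ge0 R j.+1 m q).
by rewrite subr_lt0 -ltr_pdivrMr //; apply: archi_boundP.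
Qed.

End StrongRegularity.

(** * Edges of configurations and doubling *)

Section Edges.

Variables (r : nat) (V : finType).

(** The vertices of a configuration are the pairs of an element v of V and a
    part i, so that an edge is a partial function from parts to V. *)
Definition edge : finType := {ffun 'I_r -> option V}.

Implicit Types (e f g : edge) (C : {set 'I_r}).

Definition dom e : {set 'I_r} := [set i | isSome (e i)].

Definition face f e : bool := [forall i, (f i == None) || (f i == e i)].

Definition restr e C : edge := [ffun i => if i \in C then e i else None].

Lemma faceP f e : reflect (forall i, f i = None \/ f i = e i) (face f e).
Proof.
apply: (iffP forallP) => H i.
  by case/orP: (H i) => /eqP; [left|right].
by apply/orP; case: (H i) => /eqP; [left|right].
Qed.

Lemma face_trans f e g : face g f -> face f e -> face g e.
Proof.
move=> /faceP gf /faceP fe; apply/faceP => i.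
case: (gf i) => gi; first by left.
by case: (fe i) => fi; [left; rewrite gi|right; rewrite gi].
Qed.

Lemma face_dom f e : face f e -> dom f \subset dom e.
Proof.
move=> /faceP fe; apply/subsetP => i; rewrite !inE.
by case: (fe i) => ->.
Qed.

Lemma face_eq f e : face f e -> (#|dom e| <= #|dom f|)%N -> f = e.
Proof.
move=> fe le; have /eqP D : dom f == dom e by rewrite eqEcard face_dom.
apply/ffunP => i; case/faceP/(_ i): (fe) => // fi.
have /setP/(_ i) : dom f = dom e by [].
by rewrite !inE fi; case: (e i).
Qed.

Lemma face_proper f e : face f e -> f != e -> dom f \proper dom e.
Proof.
move=> fe; apply: contraNT; rewrite properEcard face_dom //= -leqNgt.
by move=> /(face_eq fe) ->.
Qed.

Lemma restr_face e C : face (restr e C) e.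
Proof.
by apply/faceP => i; rewrite ffunE; case: ifP => _; [right|left].
Qed.

Lemma dom_restr e C : C \subset dom e -> dom (restr e C) = C.
Proof.
move=> /subsetP Ce; apply/setP => i; rewrite inE ffunE.
by case: ifP => // /Ce; rewrite inE.
Qed.

Definition common e f : {set 'I_r} := [set i | isSome (e i) && (f i == e i)].

Lemma common_proper e f : ~~ face e f -> common e f \proper dom e.
Proof.
move=> nf; rewrite properE; apply/andP; split.
  by apply/subsetP => i; rewrite !inE => /andP[].
apply: contra nf => /subsetP sub; apply/faceP => i.
case E : (e i) => [v|]; [right|by left].
by have := sub i; rewrite !inE E /= => /(_ isT)/eqP ->.
Qed.

Definition down_closed (G : {set edge}) : Prop :=
  forall f e, e \in G -> face f e -> f \in G.

Definition proper_faces e : {set edge} := [set f | face f e & f != e].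

Lemma proper_faces_closed e : down_closed (proper_faces e).
Proof.
move=> f g; rewrite !inE => /andP[ge gne] fg.
rewrite (face_trans fg ge) /=; apply: contraNneq gne => fe.
by rewrite fe in fg; apply/eqP; apply: face_eq => //; apply/subset_leq_card/face_dom.
Qed.

End Edges.

Arguments edge : clear implicits.

Section Doubling.

Variables (r : nat) (V : finType) (e : edge r V).

(** The two copies of a configuration glued along the vertices of e; these
    common vertices are collected in the single extra copy None of the index
    set. *)
Definition embed (b : bool) (f : edge r V) : edge r (option (V * bool)%type) :=
  [ffun i => if f i is Some v
             then (if e i == Some v then Some None else Some (Some (v, b)))
             else None].

Definition unembed (g : edge r (option (V * bool)%type)) : edge r V :=
  [ffun i => match g i with
             | None => None
             | Some None => e i
             | Some (Some (v, _)) => Some v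
             end].

Lemma embedK b : cancel (embed b) unembed.
Proof.
move=> f; apply/ffunP => i; rewrite !ffunE; case: (f i) => // v.
by case: eqP.
Qed.

Lemma dom_embed b f : dom (embed b f) = dom f.
Proof.
apply/setP => i; rewrite !inE ffunE; case: (f i) => // v.
by case: ifP.
Qed.

Lemma embed_face f : face f e -> embed true f = embed false f.
Proof.
move=> /faceP fe; apply/ffunP => i; rewrite !ffunE.
by case: (fe i) => ->; case E : (e i) => [v|] //; rewrite eqxx.
Qed.

Lemma embed_eq f g : embed true f = embed false g -> f = g /\ face f e.
Proof.
move=> E; have fg : f = g by rewrite -(embedK true f) E embedK.
split=> //; apply/faceP => i; move/ffunP/(_ i): E; rewrite -fg !ffunE.
by case: (f i) => [v|]; [case: eqP => // -> _; right|left].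
Qed.

Definition doubled (G : {set edge r V}) : {set edge r (option (V * bool)%type)} :=
  (embed false @: G) :|: (embed true @: G).

Lemma embed_closed b (G : {set edge r V}) :
  down_closed G -> down_closed (embed b @: G).
Proof.
move=> dG g f0 /imsetP[f fG ->] /faceP gf; apply/imsetP.
exists (restr f (dom g)); first exact: dG fG (restr_face _ _).
apply/ffunP => i; rewrite !ffunE inE.
case: (gf i) => E; rewrite E ?ffunE //=.
by case: (f i) => [v|] //; case E2: (e i == Some v); rewrite /= E2.
Qed.

Lemma doubled_closed (G : {set edge r V}) :
  down_closed G -> down_closed (doubled G).
Proof.
move=> dG f g; rewrite !inE => /orP[] gG fg; apply/orP; [left|right];
exact: embed_closed gG fg.
Qed.

Lemma card_doubled (G : {set edge r V}) : (#|doubled G| <= 2 * #|G|)%N.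
Proof.
apply: leq_trans (leq_card_setU _ _) _.
by rewrite mul2n -addnn leq_add // leq_imset_card.
Qed.

Lemma doubled_dom (G : {set edge r V}) g :
  g \in doubled G -> exists2 f, f \in G & dom g = dom f.
Proof.
by rewrite inE => /orP[] /imsetP[f fG ->]; exists f; rewrite ?dom_embed.
Qed.

Lemma prod_doubled (R : comPzRingType) (w : {set 'I_r} -> R) (G : {set edge r V}) :
  (forall f, f != e -> face f e -> f \in G) -> e \notin G ->
  (\prod_(g in doubled G) w (dom g)) * (\prod_(f in proper_faces e) w (dom f)) =
  (\prod_(f in G) w (dom f)) ^+ 2.
Proof.
move=> Ge eG.
have im b (S : {set edge r V}) : \prod_(g in embed b @: S) w (dom g) =
    \prod_(f in S) w (dom f).
  rewrite big_imset /=; last by move=> f g _ _; apply: can_inj (embedK b) _ _.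
  by apply: eq_bigr => f _; rewrite dom_embed.
have I : (embed false @: G) :&: (embed true @: G) =
         embed false @: proper_faces e.
  apply/setP => g; rewrite inE; apply/andP/imsetP.
    case=> /imsetP[f fG ->] /imsetP[f' f'G E].
    have [E1 E2] := embed_eq (esym E).
    exists f => //; rewrite inE -E1 E2 /=.
    by apply: contraNneq eG => <-.
  case=> f; rewrite inE => /andP[fe fne] ->.
  have fG := Ge f fne fe.
  by split; last rewrite -embed_face //; apply: imset_f.
rewrite -(im false) -I setIC expr2 -{2}(im true) -(im false G).
rewrite [X in _ = _ * X](big_setID (embed false @: G)) /=.
rewrite /doubled (big_setID (embed false @: G)) /=.
rewrite setUK setDUl setDv set0U.
by rewrite -mulrA; congr (_ * _); rewrite mulrC.
Qed.

End Doubling.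

(** * Placing configurations; error and uniform terms *)

Section Placement.

Variables (R : realType) (r : nat) (X : 'I_r -> finType).
Implicit Types (x z : all_tuples X).

(** A map y places all vertices of a configuration, the vertex v of part i at
    y v i. The coordinates outside e are filled in from the base point x; colours
    of the index of e do not depend on them. *)
Definition place (V : finType) x (y : {ffun V -> all_tuples X})
    (e : edge r V) : all_tuples X :=
  [ffun i => if e i is Some v then y v i else x i].

Definition subst_at (V : finType) (e : edge r V)
    (y : {ffun V -> all_tuples X}) z : {ffun V -> all_tuples X} :=
  [ffun v => [ffun i => if e i == Some v then z i else y v i] : all_tuples X].

(** The coordinates of z exchange their places with those of the vertices of
    e, which is a measure-preserving involution. *)
Lemma avg_subst_at (V : finType) (e : edge r V) x
    (F : {ffun V -> all_tuples X} -> R) :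
  avg F = avg (fun y => avg (fun z => F (subst_at e y z))).
Proof.
have T0 : (0 < #|all_tuples X|)%N by apply/card_gt0P; exists x.
pose h (p : {ffun V -> all_tuples X} * all_tuples X) :=
  (subst_at e p.1 p.2, place p.2 p.1 e).
have hK : involutive h.
  move=> [y z]; rewrite /h /=; congr (_, _).
    apply/ffunP => v; apply/ffunP => i; rewrite !ffunE.
    by case: eqP => // ->.
  apply/ffunP => i; rewrite !ffunE.
  by case E : (e i) => [v|] //; rewrite !ffunE E eqxx.
by rewrite -(avg_swap F T0 hK) avg_pair.
Qed.

Lemma place_subst_at (V : finType) (e : edge r V) x y z i :
  i \in dom e -> place x (subst_at e y z) e i = z i.
Proof.
by rewrite inE ffunE; case E : (e i) => [v|] // _; rewrite !ffunE E eqxx.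
Qed.

Lemma place_face (V : finType) (f e : edge r V) x y i :
  face f e -> i \in dom f -> place x y f i = place x y e i.
Proof.
move=> /faceP fe; rewrite inE !ffunE.
by case: (fe i) => ->.
Qed.

Lemma place_common (V : finType) (e f : edge r V) x y z z' :
  (forall i, i \in common e f -> z i = z' i) ->
  place x (subst_at e y z) f = place x (subst_at e y z') f.
Proof.
move=> zz; apply/ffunP => i; rewrite !ffunE.
case E : (f i) => [v|] //; rewrite !ffunE; case: eqP => // e_i.
by apply: zz; rewrite inE E e_i /=.
Qed.

Definition glue_copies (V : finType)
    (p : all_tuples X * ({ffun V -> all_tuples X} * {ffun V -> all_tuples X})) :
    {ffun option (V * bool)%type -> all_tuples X} :=
  [ffun o => match o with
             | None => p.1
             | Some (v, b) => if b then p.2.2 v else p.2.1 v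
             end].

Lemma glue_copies_bij (V : finType) : bijective (@glue_copies V).
Proof.
exists (fun Y : {ffun option (V * bool)%type -> all_tuples X} =>
  (Y None, ([ffun v => Y (Some (v, false))], [ffun v => Y (Some (v, true))]))).
  by case=> z [y y']; rewrite !ffunE /=; congr (_, (_, _));
    apply/ffunP => v; rewrite !ffunE.
by move=> Y; apply/ffunP => -[[v []]|]; rewrite !ffunE //= ffunE.
Qed.

Lemma place_glue_copies (V : finType) (e f : edge r V) b x z y y' :
  place x (glue_copies (z, (y, y'))) (embed e b f) =
  place x (subst_at e (if b then y' else y) z) f.
Proof.
apply/ffunP => i; rewrite !ffunE; case: (f i) => // v.
by case E : (e i == Some v); rewrite !ffunE E //=; case: b.
Qed.

End Placement.

Section Counting.

Variables (R : realType) (r : nat) (X : 'I_r -> finType).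
Variables (q : {set 'I_r} -> all_tuples X -> nat) (x : all_tuples X).
Hypothesis aq : adapted q.
Implicit Types (A C : {set 'I_r}).

Definition hit (V : finType) (f : edge r V) (y : {ffun V -> all_tuples X}) : bool :=
  q (dom f) (place x y f) == q (dom f) x.

Definition all_hit (V : finType) (G : {set edge r V})
    (y : {ffun V -> all_tuples X}) : bool :=
  [forall (f | f \in G), hit f y].

Definition count_hits (V : finType) (G : {set edge r V}) : R :=
  avg (fun y => (all_hit G y)%:R).

(** The relative density delta_A of the chain at x. *)
Definition density (A : {set 'I_r}) : R := local_density R q A (q A x) x.

Definition in_cell (A : {set 'I_r}) (z : all_tuples X) : bool :=
  lower_key q A z == lower_key q A x.

Lemma density_ge0 A : 0 <= density A.
Proof. exact: local_density_ge0. Qed.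

Lemma density_le1 A : density A <= 1.
Proof. exact: local_density_le1. Qed.

Lemma prod_density_ge0 (I : finType) (P : pred I) (F : I -> {set 'I_r}) :
  0 <= \prod_(i | P i) density (F i).
Proof. by apply: prodr_ge0 => i _; apply: density_ge0. Qed.

Lemma all_hit_sub (V : finType) (G G' : {set edge r V}) y :
  G' \subset G -> all_hit G y -> all_hit G' y.
Proof.
move=> /subsetP s /forall_inP H; apply/forall_inP => f /s; exact: H.
Qed.

Lemma in_cellE (V : finType) (e : edge r V) y :
  in_cell (dom e) (place x y e) = all_hit (proper_faces e) y.
Proof.
have hitE f : face f e -> hit f y = (q (dom f) (place x y e) == q (dom f) x).
  move=> fe; rewrite /hit (aq (A := dom f) (y := place x y e)) // => i.
  exact: place_face.
rewrite /in_cell lower_key_eqE; apply/forall_inP/forall_inP => H.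
  move=> f; rewrite inE => /andP[fe fne]; rewrite hitE //.
  by apply: H; apply: face_proper.
move=> C Ce; have CE := dom_restr (proper_sub Ce).
have := H (restr e C); rewrite hitE ?restr_face // CE; apply.
rewrite inE restr_face /=; apply: contraTneq Ce => E.
by rewrite -CE E properE subxx.
Qed.

Lemma avg_in_cell (V : finType) (e : edge r V) :
  avg (fun z => (in_cell (dom e) z)%:R) = count_hits (proper_faces e).
Proof.
rewrite /count_hits (avg_subst_at e x).
have V0 : (0 < #|{: {ffun V -> all_tuples X}}|)%N.
  by apply/card_gt0P; exists [ffun=> x].
rewrite -[LHS](avg_const _ V0); apply: eq_avg => y; apply: eq_avg => z.
rewrite -in_cellE; congr (nat_of_bool _)%:R.
rewrite /in_cell (lower_key_depends aq (x := z) (y := place x (subst_at e y z) e)) //.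
by move=> i ie; rewrite place_subst_at.
Qed.

(** The extra copy None of the doubled configuration carries the common
    vertices z, over which the square is averaged. *)
Lemma count_doubled (V : finType) (e : edge r V) (G : {set edge r V}) :
  count_hits (doubled e G) =
  avg (fun z => avg (fun y => (all_hit G (subst_at e y z))%:R) ^+ 2).
Proof.
rewrite /count_hits (avg_bij _ (glue_copies_bij X V)) avg_pair.
apply: eq_avg => z; rewrite avg_pair expr2 -avgZ; apply: eq_avg => y'.
rewrite mulrC -avgZ; apply: eq_avg => y.
have E b : all_hit (embed e b @: G) (glue_copies (z, (y', y))) =
           all_hit G (subst_at e (if b then y else y') z).
  apply/forall_inP/forall_inP => [H f fG|H g /imsetP[f fG ->]].
    have := H _ (imset_f (embed e b) fG).
    by rewrite /hit dom_embed place_glue_copies.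
  by rewrite /hit dom_embed place_glue_copies; apply: H.
rewrite -natrM mulnb; congr (nat_of_bool _)%:R.
rewrite -(E false) -(E true).
apply/forall_inP/andP => [H|[/forall_inP H1 /forall_inP H2] f].
  by split; apply/forall_inP => f fG; apply: H; rewrite inE fG ?orbT.
by rewrite inE => /orP[/H1|/H2].
Qed.

(** A single application of the Cauchy-Schwarz inequality decouples the error
    term on the edge e from the rest of the configuration, at the price of
    counting the doubled configuration; the weights of the two sides agree
    since the proper faces of e are the only edges shared by both copies. *)
Lemma error_term_le (V : finType) (e : edge r V) (G : {set edge r V})
    (err : all_tuples X -> R) (eta C : R) :
  depends_on (dom e) err -> 0 <= eta -> 0 <= C ->
  cexp (lower_key q (dom e)) (fun z => err z ^+ 2) x <= eta ->
  (forall f, f != e -> face f e -> f \in G) -> e \notin G ->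
  count_hits (proper_faces e) <= C * \prod_(f in proper_faces e) density (dom f) ->
  count_hits (doubled e G) <= C * \prod_(f in doubled e G) density (dom f) ->
  avg (fun y => `|err (place x y e)| * (all_hit G y)%:R) ^+ 2 <=
  eta * C ^+ 2 * (\prod_(f in G) density (dom f)) ^+ 2.
Proof.
move=> derr eta0 C0 Herr Ge eG HS HD.
pose W z := avg (fun y => (all_hit G (subst_at e y z))%:R) : R.
pose s z : R := (in_cell (dom e) z)%:R.
have W0 z : 0 <= W z by apply: avg_ge0 => y; rewrite ler0n.
have sW z : s z * W z = W z.
  rewrite /s; case E : (in_cell _ z); first by rewrite mul1r.
  rewrite mul0r /W /avg big1 ?mulr0 // => y _.
  case H : (all_hit _ _) => //.
  have : in_cell (dom e) (place x (subst_at e y z) e).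
    rewrite in_cellE; apply: all_hit_sub H; apply/subsetP => f.
    by rewrite inE => /andP[f1 f2]; apply: Ge.
  rewrite /in_cell (lower_key_depends aq (y := z)); last first.
    by move=> i ie; rewrite place_subst_at.
  by rewrite -/(in_cell _ z) E.
have -> : avg (fun y => `|err (place x y e)| * (all_hit G y)%:R) =
          avg (fun z => (`|err z| * s z) * W z).
  rewrite (avg_subst_at e x) avg_exchange; apply: eq_avg => z.
  rewrite -mulrA sW -avgZ; apply: eq_avg => y.
  rewrite (derr (place x (subst_at e y z) e) z) // => i ie.
  by rewrite place_subst_at.
apply: (le_trans (cauchy_schwarz_avg _ _)).
have -> : avg (fun z => (`|err z| * s z) ^+ 2) =
          cexp (lower_key q (dom e)) (fun z => err z ^+ 2) x *
          count_hits (proper_faces e).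
  rewrite -avg_in_cell -avg_fibre; apply: eq_avg => z.
  rewrite /s /in_cell exprMn -normrX ger0_norm ?sqr_ge0 // mulrC.
  by rewrite -natrX; case: (lower_key _ _ _ == _).
rewrite -count_doubled -(prod_doubled _ Ge eG).
set S := \prod_(f in proper_faces e) _; set D := \prod_(f in doubled e G) _.
have S0 : 0 <= count_hits (proper_faces e).
  by apply: avg_ge0 => y; rewrite ler0n.
have D0 : 0 <= count_hits (doubled e G).
  by apply: avg_ge0 => y; rewrite ler0n.
have c0 : 0 <= cexp (lower_key q (dom e)) (fun z => err z ^+ 2) x.
  by apply: cexp_ge0 => z; apply: sqr_ge0.
have -> : eta * C ^+ 2 * (D * S) = (eta * (C * S)) * (C * D) by ring.
apply: ler_pM => //; first exact: mulr_ge0.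
exact: ler_pM.
Qed.

(** Once the coordinates outside e are fixed, the indicator of each other edge
    depends on a proper subset of the coordinates of e. *)
Lemma uniform_term_le (V : finType) (e : edge r V) (G : {set edge r V})
    (unf : all_tuples X -> R) (theta : R) :
  depends_on (dom e) unf -> 0 <= theta -> uniform_on (dom e) theta unf ->
  (forall f, f \in G -> ~~ face e f) ->
  `|avg (fun y => unf (place x y e) * (all_hit G y)%:R)| <= theta.
Proof.
move=> dunf th0 unif nf; rewrite (avg_subst_at e x).
apply: (le_trans (ler_norm_avg _)); apply: avg_le_const => // y.
pose b C z := [forall (f | f \in G), (common e f == C) ==> hit f (subst_at e y z)].
have ab : adapted b.
  move=> C z z' zz; rewrite /b; apply: eq_forallb => f.
  case: (f \in G) => //=; case: eqP => //= cf; rewrite /hit.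
  by rewrite (place_common x y (z' := z')) // cf.
have -> : avg (fun z => unf (place x (subst_at e y z) e) *
            (all_hit G (subst_at e y z))%:R) =
          avg (fun z => unf z *
            [forall (C : {set 'I_r} | C \proper dom e), b C z]%:R); last first.
  exact: unif.
apply: eq_avg => z; rewrite (dunf _ z); last first.
  by move=> i ie; rewrite place_subst_at.
congr (_ * (nat_of_bool _)%:R); apply/forall_inP/forall_inP => H.
  move=> C _; apply/forall_inP => f fG; apply/implyP => _; exact: H.
move=> f fG; have /forall_inP/(_ f fG) : b (common e f) z; last by rewrite eqxx.
by apply: H; apply: common_proper; apply: nf.
Qed.

End Counting.

(** * The upper counting lemma *)

Lemma ler_sqr_ge0 (R : realType) (a b : R) : 0 <= b -> a ^+ 2 <= b ^+ 2 -> a <= b.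
Proof.
move=> b0 ab; case: (leP a 0) => [a0|a0]; first exact: le_trans a0 b0.
by rewrite -(ler_pXn2r (n := 2)) // ?nnegrE // ltW.
Qed.

Lemma prodr_ge_exp (R : realType) (I : finType) (G : {set I}) (F : I -> R) (c : R) :
  0 <= c -> (forall i, i \in G -> c <= F i) -> c ^+ #|G| <= \prod_(i in G) F i.
Proof.
by move=> c0 cF; rewrite -prodr_const; apply: ler_prod => i iG; rewrite c0 cF.
Qed.

(** The powers of 2 lost in the counting estimates are absorbed by the factor
    4 dividing the density. *)
Lemma error_absorbed (R : realType) (c : R) (n n1 n2 : nat) :
  0 <= c <= 1 -> (0 < n)%N -> (n1 <= 4 * n)%N -> (n2 <= 4 * n)%N ->
  (c / 4) ^+ (4 * n) * 2 ^+ n1 <= c ^+ n2 / 4.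
Proof.
move=> /andP[c0 c1] n0 n1n n2n; rewrite expr_div_n.
have -> : (4 : R) ^+ (4 * n) = 2 ^+ (8 * n).
  by rewrite (_ : 4 = 2 ^+ 2) -?exprM; [congr (_ ^+ _); lia|ring].
rewrite mulrAC -mulrA; apply: ler_pM.
- exact: exprn_ge0.
- by rewrite divr_ge0 // exprn_ge0.
- exact: ler_wiXn2l.
- rewrite ler_pdivrMr ?exprn_gt0 // mulrC ler_pdivlMr ?ltr0n //.
  rewrite (_ : (4 : R) = 2 ^+ 2); last by ring.
  by rewrite -exprD ler_eXn2l ?ltr1n //; lia.
Qed.

Section UpperCount.

Variables (R : realType) (r : nat) (X : 'I_r -> finType).
Variables (q : {set 'I_r} -> all_tuples X -> nat) (x : all_tuples X).
Hypothesis aq : adapted q.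
Implicit Types (A C : {set 'I_r}).

Variables (d eta : nat -> R) (dmin theta : R).

Local Notation density := (density R q x).
Local Notation count_hits := (count_hits R q x).

(** What is used of a point x: its own relative density is not small, and the
    mean-square error is small over the cell of x, not merely globally. *)
Definition good_at A : Prop :=
  d #|A| <= density A /\ exists err unf : all_tuples X -> R,
  [/\ depends_on A err, depends_on A unf,
      forall z, colour_ind R q A (q A x) z =
        local_density R q A (q A x) z + err z + unf z,
      cexp (lower_key q A) (fun z => err z ^+ 2) x <= eta #|A|
    & uniform_on A theta unf].

Variables (j B : nat).
Hypothesis B_gt0 : (0 < B)%N.
Hypothesis good : forall A, (#|A| < j)%N -> good_at A.
Hypothesis dmin_gt0 : 0 < dmin.
Hypothesis d_bounds : forall i, (i < j)%N -> dmin <= d i <= 1.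
Hypothesis eta_bounds : forall i, (i < j)%N -> 0 <= eta i <= (d i / 4) ^+ (4 * B).
Hypothesis theta_bounds : 0 <= theta <= dmin ^+ B / 2.

Lemma dmin_density A : (#|A| < j)%N -> dmin <= density A.
Proof.
move=> Aj; have [dA _] := good Aj; have /andP[H _] := d_bounds Aj.
exact: le_trans H dA.
Qed.

(** Edges of the largest size are removed one at a time. The structured part
    of the removed edge contributes its density, and the two remaining parts
    are bounded by half of the expected count: the mean-square error is small
    compared with the densities of its own level, and the lower levels are
    accounted for by the induction hypothesis on the doubled configuration. *)
Lemma count_hits_le i (V : finType) (G : {set edge r V}) :
  (i <= j)%N -> down_closed G -> (forall f, f \in G -> (#|dom f| < i)%N) ->
  (#|G| * 2 ^ i <= B)%N ->
  count_hits G <= 2 ^+ #|G| * \prod_(f in G) density (dom f).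
Proof.
elim: i V G => [|i IHi] V G ij dG Gi GB.
  have -> : G = set0.
    by apply/setP => f; rewrite inE; apply/negP => /Gi.
  rewrite cards0 big_set0 mulr1 expr0.
  by apply: avg_le_const => // y; rewrite lern1 leq_b1.
have [t] := ubnP #|[set f in G | #|dom f| == i]|.
elim: t G dG Gi GB => [//|t IHt] G dG Gi GB.
case: (set_0Vmem [set f in G | #|dom f| == i]) => [G0 _|[e]].
  apply: IHi => //; first exact: ltnW.
    move=> f fG; have := Gi f fG; rewrite ltnS leq_eqVlt => /orP[fi|//].
    by move/setP/(_ f): G0; rewrite !inE fG fi.
  by apply: leq_trans GB; rewrite leq_mul2l leq_exp2l // leqnSn orbT.
rewrite inE => /andP[eG /eqP ei]; rewrite ltnS => Gt.
have nface f : f \in G :\ e -> ~~ face e f.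
  rewrite !inE => /andP[fe fG]; apply: contra fe => ef; apply/eqP.
  by rewrite (face_eq ef) // ei -ltnS Gi.
have dG1 : down_closed (G :\ e).
  move=> f g gG fg; rewrite !inE (dG f g) ?andbT //; last first.
    by move: gG; rewrite inE => /andP[].
  by apply: contraNneq (nface g gG) => <-.
have cG : #|G| = (#|G :\ e|).+1 by rewrite (cardsD1 e) eG.
pose G' := [set f in G | (#|dom f| < i)%N].
have G'G : G' \subset G :\ e.
  apply/subsetP => f; rewrite !inE => /andP[-> fi]; rewrite andbT.
  by apply: contraTneq fi => ->; rewrite ei ltnn.
have dG' : down_closed G'.
  move=> f g; rewrite !inE => /andP[gG gi] fg; rewrite (dG f g) //=.
  by apply: leq_ltn_trans gi; apply/subset_leq_card/face_dom.
have eG' : e \notin G' by rewrite inE ei ltnn andbF.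
have faceG' f : f != e -> face f e -> f \in G'.
  move=> fe fface; rewrite inE (dG f e) //= -ei.
  by apply: proper_card; apply: face_proper.
have cG' : (#|G'| < #|G|)%N.
  by rewrite cG ltnS subset_leq_card.
have Aj : (#|dom e| < j)%N by rewrite ei.
have [dA [err [unf [derr dunf split_q Herr Hunf]]]] := good Aj.
have /andP[th0 thB] := theta_bounds.
rewrite ei in dA Herr.
have /andP[eta0 etaB] := eta_bounds ij.
have /andP[dmini di1] := d_bounds ij.
have di0 : 0 < d i by apply: lt_le_trans dmin_gt0 dmini.
have dmin1 : dmin <= 1 by apply: le_trans dmini di1.
set P := \prod_(f in G) density (dom f).
have P0 : 0 <= P by apply: prod_density_ge0.
have GB' : (#|G| <= B)%N.
  by apply: leq_trans GB; rewrite leq_pmulr // expn_gt0.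
have Pge : dmin ^+ B <= P.
  apply: (@le_trans _ _ (dmin ^+ #|G|)).
    by rewrite ler_wiXn2l // ltW.
  apply: prodr_ge_exp => [|f fG]; first exact: ltW.
  by apply: dmin_density; apply: leq_trans (Gi f fG) ij.
have main : avg (fun y => local_density R q (dom e) (q (dom e) x) (place x y e) *
    (all_hit q x (G :\ e) y)%:R) <= 2 ^+ #|G :\ e| * P.
  have -> : avg (fun y => local_density R q (dom e) (q (dom e) x) (place x y e) *
    (all_hit q x (G :\ e) y)%:R) = density (dom e) * count_hits (G :\ e).
    rewrite -avgZ; apply: eq_avg => y; case H : (all_hit _ _ _ _); last by rewrite !mulr0.
    congr (_ * _); apply: cexp_key; apply/eqP.
    rewrite -/(in_cell q x (dom e) _) in_cellE //.
    apply: all_hit_sub H; apply/subsetP => f; rewrite inE => /andP[f1 f2].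
    by apply: (subsetP G'G); apply: faceG'.
  have -> : P = density (dom e) * \prod_(f in G :\ e) density (dom f).
    by rewrite /P (big_setD1 e).
  rewrite [leRHS]mulrCA; apply: ler_wpM2l; first exact: density_ge0.
  apply: IHt => //.
  - by move=> f; rewrite inE => /andP[_]; apply: Gi.
  - by apply: leq_trans GB; rewrite leq_mul2r cG leqnSn orbT.
  - apply: leq_trans Gt; rewrite [X in (_ < X)%N](cardsD1 e) inE eG ei eqxx /=.
    rewrite add1n ltnS; apply: subset_leq_card; apply/subsetP => f.
    by rewrite !inE -andbA.
have error : avg (fun y => `|err (place x y e)| * (all_hit q x (G :\ e) y)%:R)
    <= P / 2.
  apply: (@le_trans _ _ (avg (fun y => `|err (place x y e)| * (all_hit q x G' y)%:R))).
    apply: avg_le => y; apply: ler_wpM2l => //; rewrite ler_nat.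
    case H : (all_hit _ _ (G :\ e) y) => //.
    by rewrite (all_hit_sub G'G H).
  apply: ler_sqr_ge0; first by rewrite divr_ge0.
  have G'B : (#|G'| * 2 ^ i.+1 <= B)%N.
    by apply: leq_trans GB; rewrite leq_mul2r ltnW ?orbT.
  pose C : R := 2 ^+ (2 * #|G'|)%N.
  have C0 : 0 <= C by apply: exprn_ge0.
  have sub : proper_faces e \subset G'.
    by apply/subsetP => f; rewrite inE => /andP[f1 f2]; apply: faceG'.
  apply: (le_trans (error_term_le (eta := eta i) aq derr eta0 C0 Herr faceG' eG' _ _)).
  - apply: le_trans (IHi _ _ (ltnW ij) (@proper_faces_closed _ _ e) _ _) _.
    + by move=> f /(subsetP sub); rewrite inE => /andP[].
    + apply: leq_trans G'B; apply: leq_mul; first exact: subset_leq_card.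
      by rewrite leq_exp2l.
    + apply: ler_wpM2r; first exact: prod_density_ge0.
      rewrite /C ler_eXn2l ?ltr1n //.
      by apply: leq_trans (subset_leq_card sub) _; rewrite leq_pmull.
  - apply: le_trans (IHi _ _ (ltnW ij) (doubled_closed dG') _ _) _.
    + by move=> f /doubled_dom[g]; rewrite inE => /andP[_ gi] ->.
    + apply: leq_trans G'B; rewrite expnS mulnA.
      by rewrite leq_mul2r [(_ * 2)%N]mulnC card_doubled orbT.
    + apply: ler_wpM2r; first exact: prod_density_ge0.
      by rewrite /C ler_eXn2l ?ltr1n // card_doubled.
  have PE : P = \prod_(f in G') density (dom f) *
                \prod_(f in G :\: G') density (dom f).
    rewrite /P (big_setID G') /= (setIidPr _) //.
    by apply: subset_trans G'G (subsetDl _ _).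
  have Ptop : d i ^+ #|G :\: G'| <= \prod_(f in G :\: G') density (dom f).
    apply: prodr_ge_exp => [|f]; first exact: ltW.
    rewrite !inE => /andP[fi fG]; move: fi; rewrite fG /= -leqNgt => fi.
    have /eqP fi' : #|dom f| == i by rewrite eqn_leq fi -ltnS Gi.
    have fj : (#|dom f| < j)%N by rewrite fi'.
    by have [] := good fj; rewrite fi'.
  have -> : (P / 2) ^+ 2 = (\prod_(f in G :\: G') density (dom f) / 2) ^+ 2 *
      (\prod_(f in G') density (dom f)) ^+ 2 by rewrite PE; ring.
  apply: ler_wpM2r; first exact: sqr_ge0.
  apply: (@le_trans _ _ ((d i ^+ #|G :\: G'|) ^+ 2 / 4)); last first.
    rewrite expr_div_n (_ : (2 : R) ^+ 2 = 4); last by ring.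
    rewrite ler_pM2r ?invr_gt0 ?ltr0n // lerXn2r // nnegrE.
      by apply: exprn_ge0; apply: ltW.
    exact: prod_density_ge0.
  rewrite /C -!exprM.
  apply: le_trans (ler_wpM2r _ etaB) _; first exact: exprn_ge0.
  apply: error_absorbed => //; first by rewrite ltW.
    rewrite mulnC mulnA leq_mul2l /=.
    exact: leq_trans (ltnW cG') GB'.
  rewrite mulnC; apply: leq_mul => //.
  exact: leq_trans (subset_leq_card (subsetDl G G')) GB'.
have uniform : avg (fun y => unf (place x y e) * (all_hit q x (G :\ e) y)%:R)
    <= P / 2.
  apply: le_trans (ler_norm _) _.
  apply: (le_trans (uniform_term_le q x dunf th0 Hunf nface)).
  by apply: (le_trans thB); rewrite ler_pM2r ?invr_gt0 ?ltr0n.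
have -> : count_hits G =
    avg (fun y => local_density R q (dom e) (q (dom e) x) (place x y e) *
      (all_hit q x (G :\ e) y)%:R) +
    avg (fun y => err (place x y e) * (all_hit q x (G :\ e) y)%:R) +
    avg (fun y => unf (place x y e) * (all_hit q x (G :\ e) y)%:R).
  rewrite -!avgD; apply: eq_avg => y; rewrite -!mulrDl -split_q /colour_ind.
  rewrite -/(hit q x e y) -natrM mulnb; congr (nat_of_bool _)%:R.
  apply/forall_inP/andP => [H|[H1 /forall_inP H2] f fG].
    split; first exact: H.
    by apply/forall_inP => f; rewrite inE => /andP[_]; apply: H.
  by have [->//|fe] := eqVneq f e; apply: H2; rewrite !inE fe.
have error' : avg (fun y => err (place x y e) * (all_hit q x (G :\ e) y)%:R)
    <= P / 2.
  apply: le_trans error; apply: avg_le => y.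
  by rewrite ler_wpM2r ?ler0n // ler_norm.
apply: (le_trans (lerD (lerD main error') uniform)).
rewrite -addrA -splitr cG exprS -mulrA mulr_natl mulr2n lerD2l.
rewrite ler_peMl //; apply: exprn_ege1; exact: (ler1n _ 2).
Qed.

End UpperCount.

(** * The octahedral bound *)

(** Uniformity is insensitive to replacing test functions by differences of
    test functions: the product is expanded one factor at a time. *)
Lemma uniform_expand (R : realType) (r : nat) (X : 'I_r -> finType)
    (A : {set 'I_r}) (theta delta : R) (unf : all_tuples X -> R)
    (I : eqType) (L : seq I) (a b : I -> all_tuples X -> bool)
    (C : I -> {set 'I_r}) :
  uniform_on A theta unf -> 0 <= delta <= 1 ->
  (forall l, l \in L ->
     [/\ C l \proper A, depends_on (C l) (a l) & depends_on (C l) (b l)]) ->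
  forall b0 : {set 'I_r} -> all_tuples X -> bool, adapted b0 ->
  `|avg (fun z => unf z *
      ([forall (D : {set 'I_r} | D \proper A), b0 D z]%:R *
       \prod_(l <- L) ((a l z)%:R - delta * (b l z)%:R)))|
    <= 2 ^+ size L * theta.
Proof.
move=> unif /andP[del0 del1]; elim: L => [|l L IH] HL b0 ab0.
  rewrite mul1r; under eq_avg => z do rewrite big_nil mulr1.
  exact: unif.
have [CA da db] := HL l (mem_head _ _).
have {}IH := IH (fun m mL => HL m (@mem_behead _ (l :: L) m mL)).
pose ext (c : all_tuples X -> bool) D z := b0 D z && ((D == C l) ==> c z).
have aext c : depends_on (C l) c -> adapted (ext c).
  move=> dc D x y xy; rewrite /ext (ab0 D x y) //; congr (_ && _).
  by case: eqP => // DC; rewrite (dc x y) // -DC.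
have extE c z : [forall (D : {set 'I_r} | D \proper A), ext c D z] =
    [forall (D : {set 'I_r} | D \proper A), b0 D z] && c z.
  apply/forall_inP/andP => [H|[/forall_inP H1 H2] D DA].
    split; first by apply/forall_inP => D /H /andP[].
    by have := H _ CA; rewrite /ext eqxx => /andP[].
  by rewrite /ext H1 // H2 implybT.
have -> : avg (fun z => unf z *
      ([forall (D : {set 'I_r} | D \proper A), b0 D z]%:R *
       \prod_(l <- l :: L) ((a l z)%:R - delta * (b l z)%:R))) =
    avg (fun z => unf z *
      ([forall (D : {set 'I_r} | D \proper A), ext (a l) D z]%:R *
       \prod_(l <- L) ((a l z)%:R - delta * (b l z)%:R))) -
    delta * avg (fun z => unf z *
      ([forall (D : {set 'I_r} | D \proper A), ext (b l) D z]%:R *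
       \prod_(l <- L) ((a l z)%:R - delta * (b l z)%:R))).
  rewrite -avgZ -avgB; apply: eq_avg => z.
  by rewrite big_cons !extE -!mulnb !natrM; ring.
apply: (le_trans (ler_normB _ _)).
rewrite [size _]/= exprS -mulrA mulr_natl mulr2n; apply: lerD.
  exact: IH (aext _ da).
rewrite normrM ger0_norm //; apply: le_trans (IH _ (aext _ db)).
by rewrite ler_piMl.
Qed.

Section DomainCount.

Variable (r : nat).
Implicit Types (A C : {set 'I_r}).

Lemma card_dom_bool C : #|[set f : edge r bool | dom f == C]| = (2 ^ #|C|)%N.
Proof.
have <- : #|[pred o : option bool | isSome o]| = 2%N.
  have -> : #|[pred o : option bool | isSome o]| = #|predC1 (@None bool)|.
    by apply: eq_card => -[].
  by rewrite cardC1 card_option card_bool.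
rewrite -(card_pffun_on None (mem C)); apply: eq_card => f.
rewrite inE; apply/eqP/pffun_onP => [fC|[fC1 fC2]].
  split=> [|o /imageP[i iC ->]]; last first.
    by move: iC; rewrite -fC !inE.
  by apply/subsetP => i; rewrite -fC !inE; case: (f i).
apply/setP => i; rewrite inE; apply/idP/idP => [fi|iC].
  by apply: (subsetP fC1); rewrite inE; case: (f i) fi.
by have := fC2 (f i) (image_f _ iC); rewrite inE.
Qed.

Lemma prod_dom_bool (R : comPzRingType) (w : {set 'I_r} -> R) (P : pred {set 'I_r}) :
  \prod_(f : edge r bool | P (dom f)) w (dom f) =
  \prod_(C : {set 'I_r} | P C) w C ^+ (2 ^ #|C|).
Proof.
rewrite (partition_big (@dom r bool) P) //=; apply: eq_bigr => C PC.
rewrite (eq_big (fun f : edge r bool => f \in [set f | dom f == C]) (fun=> w C)).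
- by rewrite prodr_const card_dom_bool.
- by move=> f; rewrite inE; case: eqP => [->|]; rewrite ?PC ?andbF.
- by move=> f /andP[_ /eqP ->].
Qed.

Lemma card_edge_bool : #|{: edge r bool}| = (3 ^ r)%N.
Proof. by rewrite card_ffun card_option card_bool card_ord. Qed.

End DomainCount.

Section OctahedralBound.

Variables (R : realType) (r : nat) (X : 'I_r -> finType).
Variables (q : {set 'I_r} -> all_tuples X -> nat) (x : all_tuples X).
Hypothesis aq : adapted q.
Implicit Types (A C : {set 'I_r}).

Variables (d eta : nat -> R) (dmin theta : R).

Local Notation density := (density R q x).
Local Notation good_at := (good_at q x d eta theta).

Definition balanced_cell A (z : all_tuples X) : R :=
  ((q A z == q A x) && in_cell q x A z)%:R - density A * (in_cell q x A z)%:R.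

(** The octahedral average of the balanced function, the corners of an
    octahedron being the edges of index A on the index set bool. *)
Definition oct_cell A : R :=
  avg (fun y : {ffun bool -> all_tuples X} =>
    \prod_(e : edge r bool | dom e == A) balanced_cell A (place x y e)).

Lemma balanced_cell_le A z : `|balanced_cell A z| <= (in_cell q x A z)%:R.
Proof.
have d0 := density_ge0 R q x A; have d1 := density_le1 R q x A.
rewrite /balanced_cell; case: (in_cell _ _ _ _); rewrite ?andbT ?andbF.
  by rewrite mulr1 ler_norml; case: eqP => _ /=; apply/andP; split; lra.
by rewrite mulr0 subrr normr0.
Qed.

Lemma all_hit_octahedron A y :
  (forall e : edge r bool, dom e = A -> in_cell q x A (place x y e)) ->
  all_hit q x [set f : edge r bool | dom f \proper A] y.
Proof.
move=> H; apply/forall_inP => f; rewrite inE => fA.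
pose e : edge r bool := [ffun i => if i \in A
  then (if f i is Some v then Some v else Some false) else None].
have de : dom e = A.
  apply/setP => i; rewrite inE ffunE; case: (i \in A) => //.
  by case: (f i).
have fe : f \in proper_faces e.
  rewrite inE; apply/andP; split; last first.
    by apply: contraTneq fA => ->; rewrite de properE subxx.
  apply/faceP => i; case E : (f i) => [v|]; [right|by left].
  have /(subsetP (proper_sub fA)) iA : i \in dom f by rewrite inE E.
  by rewrite ffunE iA E.
have := H e de; rewrite -{1}de in_cellE //.
by move=> /forall_inP/(_ f fe).
Qed.

Variables (j B : nat).
Hypothesis good : forall A, (#|A| < j)%N -> good_at A.
Hypothesis dmin_gt0 : 0 < dmin.
Hypothesis d_bounds : forall i, (i <= j)%N -> dmin <= d i <= 1.
Hypothesis eta_bounds : forall i, (i < j)%N -> 0 <= eta i <= (d i / 4) ^+ (4 * B).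
Hypothesis B_large : (3 ^ r * 2 ^ j.+1 <= B)%N.

(** Only one of the factors of the octahedral average needs to be decomposed:
    its structured part is cancelled by the balancing, its mean-square error
    is controlled by counting doubled octahedra, and its uniform part by
    expanding the other factors into test functions. *)
Lemma oct_cell_le A (et : R) : #|A| = j -> good_at A ->
  0 <= et <= 1 -> 0 <= eta j <= et ^+ 2 * (d j / 4) ^+ (4 * B) ->
  0 <= theta <= et * (dmin / 2) ^+ B / 2 ->
  oct_cell A <= et * \prod_(C : {set 'I_r} | C \subset A) density C ^+ (2 ^ #|C|).
Proof.
move=> Aj [dA [err [unf [derr dunf split_q Herr Hunf]]]] /andP[et0 et1].
move=> /andP[eta0 etaB] /andP[th0 thB].
rewrite Aj in dA Herr.
have /andP[dmin_j dj1] := d_bounds (leqnn j).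
have dj0 : 0 < d j by apply: lt_le_trans dmin_gt0 dmin_j.
have dmin1 : dmin <= 1 by apply: le_trans dmin_j dj1.
have N0 : (0 < 3 ^ r)%N by rewrite expn_gt0.
have NB : (3 ^ r <= B)%N.
  by apply: leq_trans B_large; rewrite leq_pmulr // expn_gt0.
have B0 : (0 < B)%N by apply: leq_trans N0 NB.
have card_le3 (G : {set edge r bool}) : (#|G| <= 3 ^ r)%N.
  by rewrite -card_edge_bool max_card.
have theta_bounds : 0 <= theta <= dmin ^+ B / 2.
  rewrite th0 /=; apply: le_trans thB _.
  rewrite ler_pM2r ?invr_gt0 ?ltr0n // -[leRHS]mul1r; apply: ler_pM => //.
    by rewrite exprn_ge0 // divr_ge0 // ltW.
  rewrite lerXn2r // ?nnegrE ?divr_ge0 ?(ltW dmin_gt0) //.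
  by rewrite ler_pdivrMr // ler_peMr ?(ltW dmin_gt0) // ler1n.
pose e0 : edge r bool := [ffun i => if i \in A then Some false else None].
have de0 : dom e0 = A.
  by apply/setP => i; rewrite inE ffunE; case: (i \in A).
pose G := [set f : edge r bool | dom f \proper A].
have dG : down_closed G.
  move=> f g; rewrite !inE => gA fg.
  exact: sub_proper_trans (face_dom fg) gA.
have e0G : e0 \notin G by rewrite inE de0 properE subxx.
have faceG f : f != e0 -> face f e0 -> f \in G.
  by move=> f1 f2; rewrite inE -de0; apply: face_proper.
have GB : (#|G| * 2 ^ j.+1 <= B)%N.
  by apply: leq_trans B_large; rewrite leq_mul2r card_le3 orbT.
set P := \prod_(C : {set 'I_r} | C \subset A) _.
have PE : P = \prod_(f in G) density (dom f) *
              \prod_(f in [set f : edge r bool | dom f == A]) density (dom f).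
  rewrite /P -(prod_dom_bool density (fun C => C \subset A)).
  rewrite (bigID (fun f : edge r bool => dom f == A)) /= mulrC; congr (_ * _).
    by apply: eq_bigl => f; rewrite inE properEneq andbC.
  apply: eq_bigl => f; rewrite inE; case: eqP => [->|]; rewrite ?andbF //.
  by rewrite subxx.
have P0 : 0 <= P.
  by rewrite PE mulr_ge0 // prod_density_ge0.
have error : avg (fun y => `|err (place x y e0)| * (all_hit q x G y)%:R)
    <= et * P / 2.
  apply: ler_sqr_ge0; first by rewrite divr_ge0 // mulr_ge0.
  pose C : R := 2 ^+ (2 * #|G|)%N.
  have C0 : 0 <= C by apply: exprn_ge0.
  have sub : proper_faces e0 \subset G.
    by apply/subsetP => f; rewrite inE => /andP[f1 f2]; apply: faceG.
  have d_bounds' i : (i < j)%N -> dmin <= d i <= 1.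
    by move=> /ltnW; apply: d_bounds.
  have count := count_hits_le aq B0 good dmin_gt0 d_bounds' eta_bounds theta_bounds.
  have derr' : depends_on (dom e0) err by rewrite de0.
  have Herr' : cexp (lower_key q (dom e0)) (fun z => err z ^+ 2) x <= eta j.
    by rewrite de0.
  apply: (le_trans (error_term_le aq derr' eta0 C0 Herr' faceG e0G _ _)).
  - apply: le_trans (count j _ _ (leqnn j) (@proper_faces_closed _ _ e0) _ _) _.
    + by move=> f /(subsetP sub); rewrite inE -Aj; apply: proper_card.
    + apply: leq_trans GB; apply: leq_mul; first exact: subset_leq_card.
      by rewrite leq_exp2l.
    + apply: ler_wpM2r; first exact: prod_density_ge0.
      rewrite /C ler_eXn2l ?ltr1n //.
      by apply: leq_trans (subset_leq_card sub) _; rewrite leq_pmull.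
  - apply: le_trans (count j _ _ (leqnn j) (doubled_closed dG) _ _) _.
    + move=> f /doubled_dom[g]; rewrite inE => gA ->.
      by rewrite -Aj; apply: proper_card.
    + apply: leq_trans GB; rewrite expnS mulnA.
      by rewrite leq_mul2r [(_ * 2)%N]mulnC card_doubled orbT.
    + apply: ler_wpM2r; first exact: prod_density_ge0.
      by rewrite /C ler_eXn2l ?ltr1n // card_doubled.
  set T := [set f : edge r bool | dom f == A].
  have Ptop : d j ^+ #|T| <= \prod_(f in T) density (dom f).
    apply: prodr_ge_exp => [|f]; first exact: ltW.
    by rewrite inE => /eqP ->.
  have -> : (et * P / 2) ^+ 2 =
      et ^+ 2 * (\prod_(f in T) density (dom f) / 2) ^+ 2 *
      (\prod_(f in G) density (dom f)) ^+ 2 by rewrite PE; ring.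
  apply: ler_wpM2r; first exact: sqr_ge0.
  apply: (@le_trans _ _ (et ^+ 2 * ((d j ^+ #|T|) ^+ 2 / 4))); last first.
    apply: ler_wpM2l; first exact: sqr_ge0.
    rewrite expr_div_n (_ : (2 : R) ^+ 2 = 4); last by ring.
    rewrite ler_pM2r ?invr_gt0 ?ltr0n // lerXn2r // nnegrE.
      by apply: exprn_ge0; apply: ltW.
    exact: prod_density_ge0.
  rewrite /C -!exprM.
  apply: le_trans (ler_wpM2r _ etaB) _; first exact: exprn_ge0.
  rewrite -mulrA; apply: ler_wpM2l; first exact: sqr_ge0.
  apply: error_absorbed => //; first by rewrite ltW.
    rewrite mulnC mulnA leq_mul2l /=.
    exact: leq_trans (card_le3 G) NB.
  rewrite mulnC; apply: leq_mul => //.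
  exact: leq_trans (card_le3 T) NB.
pose rest y := \prod_(e : edge r bool | (dom e == A) && (e != e0))
                 balanced_cell A (place x y e).
have uniform : avg (fun y => unf (place x y e0) *
    ((in_cell q x A (place x y e0))%:R * rest y)) <= et * P / 2.
  apply: le_trans (ler_norm _) _; rewrite (avg_subst_at e0 x).
  apply: (le_trans (ler_norm_avg _)); apply: avg_le_const => [|y].
    by rewrite divr_ge0 // mulr_ge0.
  pose L := enum [pred e : edge r bool | (dom e == A) && (e != e0)].
  pose pl e z := place x (subst_at e0 y z) e.
  pose a e z := (q A (pl e z) == q A x) && in_cell q x A (pl e z).
  pose b e z := in_cell q x A (pl e z).
  have HL l : l \in L -> [/\ common e0 l \proper A,
      depends_on (common e0 l) (a l) & depends_on (common e0 l) (b l)].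
    rewrite mem_enum inE => /andP[/eqP dl le0]; split.
    - have := @common_proper _ _ e0 l; rewrite de0; apply.
      by apply: contra le0 => /face_eq -> //; rewrite dl de0.
    - by move=> z z' zz; rewrite /a /pl (place_common x y zz).
    - by move=> z z' zz; rewrite /b /pl (place_common x y zz).
  pose b0 C z := q C z == q C x.
  have ab0 : adapted b0 by move=> C z z' zz; rewrite /b0 (aq zz).
  have del01 : 0 <= density A <= 1 by rewrite density_ge0 density_le1.
  have := uniform_expand Hunf del01 HL ab0.
  have -> : avg (fun z => unf z *
      ([forall (D : {set 'I_r} | D \proper A), b0 D z]%:R *
       \prod_(l <- L) ((a l z)%:R - density A * (b l z)%:R))) =
    avg (fun z => unf (place x (subst_at e0 y z) e0) *
      ((in_cell q x A (place x (subst_at e0 y z) e0))%:R *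
       rest (subst_at e0 y z))).
    apply: eq_avg => z.
    have zE i : i \in A -> place x (subst_at e0 y z) e0 i = z i.
      by move=> iA; rewrite place_subst_at ?de0.
    rewrite (dunf _ _ zE) /in_cell (lower_key_depends aq zE) lower_key_eqE.
    by congr (_ * (_ * _)); rewrite /L big_enum.
  move=> H; apply: (le_trans H).
  have LB : (size L <= B)%N.
    by rewrite -cardE; apply: leq_trans NB; rewrite -card_edge_bool max_card.
  apply: (@le_trans _ _ (2 ^+ B * (et * (dmin / 2) ^+ B / 2))).
    by apply: ler_pM => //; rewrite ?exprn_ge0 // ler_eXn2l ?ltr1n.
  have -> : 2 ^+ B * (et * (dmin / 2) ^+ B / 2) = et * dmin ^+ B / 2 :> R.
    by rewrite expr_div_n; field; rewrite expf_neq0 // pnatr_eq0.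
  rewrite ler_pM2r ?invr_gt0 ?ltr0n //; apply: ler_wpM2l => //.
  rewrite /P -(prod_dom_bool density (fun C => C \subset A)).
  rewrite (eq_bigl (fun f : edge r bool =>
    f \in [set f : edge r bool | dom f \subset A])); last by move=> f; rewrite inE.
  apply: le_trans (prodr_ge_exp (c := dmin) _ _).
  - by rewrite ler_wiXn2l ?(ltW dmin_gt0) // (leq_trans (card_le3 _)).
  - exact: ltW.
  - move=> f; rewrite inE subEproper => /orP[/eqP ->|/proper_card].
      exact: le_trans dmin_j dA.
    rewrite Aj => fj; have [df _] := good fj.
    have /andP[df' _] := d_bounds (ltnW fj).
    exact: le_trans df' df.
have restB y : `|(in_cell q x A (place x y e0))%:R * rest y| <= (all_hit q x G y)%:R.
  apply: (@le_trans _ _ (\prod_(e : edge r bool | dom e == A)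
      (in_cell q x A (place x y e))%:R)).
    rewrite (bigD1 e0) ?de0 //= normrM normr_nat; apply: ler_wpM2l => //.
    rewrite normr_prod; apply: ler_prod => e _.
    by rewrite normr_ge0 balanced_cell_le.
  case: (boolP [forall (e : edge r bool | dom e == A), in_cell q x A (place x y e)]).
    move=> /forall_inP H; rewrite all_hit_octahedron; last first.
      by move=> e /eqP; apply: H.
    by apply: prodr_ile1 => e _; rewrite ler0n lern1 leq_b1.
  move=> /forall_inPn[e eA /negbTE He].
  rewrite (bigD1 e) //= He mul0r; exact: ler0n.
have -> : oct_cell A =
    avg (fun y => err (place x y e0) *
      ((in_cell q x A (place x y e0))%:R * rest y)) +
    avg (fun y => unf (place x y e0) *
      ((in_cell q x A (place x y e0))%:R * rest y)).
  rewrite -avgD; apply: eq_avg => y; rewrite (bigD1 e0) ?de0 //= -/(rest y).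
  rewrite -mulrDl mulrA; congr (_ * _).
  rewrite /balanced_cell; case E : (in_cell _ _ _ _); last first.
    by rewrite andbF !mulr0 subrr.
  rewrite andbT !mulr1 -/(colour_ind R q A (q A x) _) split_q.
  have -> : density A = local_density R q A (q A x) (place x y e0).
    by apply: cexp_key; apply/esym/eqP.
  ring.
have error' : avg (fun y => err (place x y e0) *
      ((in_cell q x A (place x y e0))%:R * rest y)) <= et * P / 2.
  apply: le_trans error; apply: avg_le => y.
  apply: le_trans (ler_norm _) _; rewrite normrM.
  by apply: ler_wpM2l => //; apply: restB.
by apply: (le_trans (lerD error' uniform)); rewrite -splitr.
Qed.

End OctahedralBound.

(** * From tuples to sets, chains and densities *)

Section Projections.

Variables (r : nat) (X : 'I_r -> finType).
Implicit Types (A C : {set 'I_r}) (x y z : all_tuples X) (B S : {set vertex X}).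

Lemma mem_proj x A (v : vertex X) :
  (v \in proj x A) = (tag v \in A) && (v == Tagged X (x (tag v))).
Proof.
apply/imsetP/andP => [[i iA ->]|[vA /eqP ->]]; first by rewrite iA eqxx.
by exists (tag v).
Qed.

Lemma proj_part x A i :
  proj x A :&: part X i = if i \in A then [set Tagged X (x i)] else set0.
Proof.
apply/setP => v; rewrite in_setI mem_proj !inE.
case: (tag v =P i) => [<-|vi]; rewrite ?andbT ?andbF.
  by case: ifP => _; rewrite inE.
by case: ifP => _; rewrite inE //; apply/esym/eqP => E; case: vi; rewrite E.
Qed.

Lemma proj_K x A : proj x A \in K X A.
Proof.
rewrite inE; apply/forallP => i; rewrite proj_part.
by case: ifP => _; rewrite ?cards1 ?cards0.
Qed.

Lemma proj_eqP x y A :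
  proj x A = proj y A <-> (forall i, i \in A -> x i = y i).
Proof.
split=> [/setP E i iA|E]; last first.
  by apply: eq_in_imset => i iA; rewrite E.
have := E (Tagged X (x i)); rewrite !mem_proj /= iA eqxx /=.
by move/esym/eqP/eqP; rewrite -tag_eqE /tag_eq eqxx /= tagged_asE => /eqP.
Qed.

Lemma idx_proj x A : idx (proj x A) = A.
Proof.
apply/setP => i; apply/imsetP/idP => [[v]|iA].
  by rewrite mem_proj => /andP[vA _] ->.
by exists (Tagged X (x i)) => //; rewrite mem_proj iA eqxx.
Qed.

Lemma card_proj x A : #|proj x A| = #|A|.
Proof.
rewrite card_in_imset // => i j _ _ /eqP.
by rewrite -tag_eqE /tag_eq => /andP[/eqP].
Qed.

Lemma K_idx A B : B \in K X A -> idx B = A.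
Proof.
rewrite inE => /forallP H; apply/setP => i; apply/imsetP/idP => [[v vB ->]|iA].
  have /eqP := H (tag v); case: (tag v \in A) => // /cards0_eq/setP/(_ v).
  by rewrite !inE vB eqxx.
have := H i; rewrite iA => /cards1P[v /setP/(_ v)].
by rewrite !inE eqxx => /andP[vB /eqP <-]; exists v.
Qed.

Lemma sub_proj x A B : B \subset proj x A -> B = proj x (idx B) /\ idx B \subset A.
Proof.
move=> /subsetP BA; split; last first.
  apply/subsetP => i /imsetP[v /BA]; rewrite mem_proj => /andP[vA _] ->.
  exact: vA.
apply/setP => v; rewrite mem_proj; apply/idP/andP => [vB|[]].
  split; first exact: imset_f.
  by move: (BA _ vB); rewrite mem_proj => /andP[].
case/imsetP => w wB vw /eqP ->; rewrite vw.
by move: (BA _ wB); rewrite mem_proj => /andP[_ /eqP <-].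
Qed.

Lemma proj_sub x A C : C \subset A -> proj x C \subset proj x A.
Proof. by move=> CA; apply: imsetS. Qed.

Lemma subidx_proj x A C : C \subset A -> subidx (proj x A) C = proj x C.
Proof.
move=> /subsetP CA; apply/setP => v; rewrite inE !mem_proj.
by case vC : (tag v \in C); rewrite ?andbF // andbT CA.
Qed.

(** A set of index A determines the coordinates in A only; the other ones are
    taken from x. *)
Definition overwrite x B : all_tuples X :=
  [ffun i => if [pick v in B | tag v == i] is Some v
             then tagged_as (Tagged X (x i)) v else x i].

Lemma proj_overwrite x A B : B \in K X A -> proj (overwrite x B) A = B.
Proof.
move=> BK; have BA := K_idx BK; move: (BK); rewrite inE => /forallP H.
have main i : i \in A -> Tagged X (overwrite x B i) \in B.
  move=> iA; rewrite ffunE; case: pickP => [v /andP[vB /eqP vi]|none].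
    case: v vB vi => j w /= vB ji; rewrite -ji in iA *.
    by rewrite tagged_asE.
  by move: iA; rewrite -BA => /imsetP[v vB iv]; have := none v; rewrite vB iv eqxx.
apply/setP => v; rewrite mem_proj; apply/andP/idP => [[vA /eqP ->]|vB].
  exact: main.
have vA : tag v \in A by rewrite -BA imset_f.
split=> //; have /eqP := H (tag v); rewrite vA => /eqP/cards1P[w Bw].
have in1 u : u \in B -> tag u = tag v -> u = w.
  by move=> uB uv; apply/eqP; rewrite -in_set1 -Bw !inE uB uv eqxx.
by apply/eqP; rewrite (in1 _ (main _ vA) erefl); apply: in1.
Qed.

Lemma overwrite_off x A B i : B \in K X A -> i \notin A -> overwrite x B i = x i.
Proof.
move=> /K_idx <- iB; rewrite ffunE; case: pickP => // v /andP[vB /eqP vi].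
by case/negP: iB; rewrite -vi imset_f.
Qed.

Lemma K_proj x A B : B \in K X A -> exists z, B = proj z A.
Proof. by move=> /(proj_overwrite x) E; exists (overwrite x B). Qed.

Definition restrict A x : tuple_on X A :=
  [ffun i : {i : 'I_r | i \in A} => x (val i)].

Lemma tuple_set_restrict A x : tuple_set (restrict A x) = proj x A.
Proof.
apply/setP => v; apply/imsetP/imsetP => [[i _ ->]|[i iA ->]].
  by exists (val i); rewrite ?(valP i) // ffunE.
by exists (Sub i iA) => //; rewrite ffunE.
Qed.

Lemma tuple_set_inj A : injective (@tuple_set r X A).
Proof.
move=> u u' E; apply/ffunP => i.
have : Tagged X (u i) \in tuple_set u' by rewrite -E; apply/imsetP; exists i.
case/imsetP => j _ /eqP; rewrite -tag_eqE /tag_eq /= => /andP[/eqP ij].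
have {}ij : i = j by apply: val_inj.
by rewrite -ij tagged_asE => /eqP.
Qed.

Lemma tuple_set_K A (u : tuple_on X A) : tuple_set u \in K X A.
Proof.
rewrite inE; apply/forallP => i; case iA : (i \in A).
  apply/cards1P; exists (Tagged X (u (Sub i iA))); apply/setP => v.
  rewrite !inE; apply/andP/eqP => [[/imsetP[j _ ->] /= /eqP ji]|->].
    have -> : j = Sub i iA by apply: val_inj.
    by [].
  by split=> //; apply/imsetP; exists (Sub i iA).
rewrite cards_eq0 -subset0; apply/subsetP => v; rewrite !inE.
case/andP => /imsetP[j _ ->] /= /eqP ji.
by have := valP j; rewrite /= ji iA.
Qed.

Variable R : realType.

(** The pair of a tuple on A and a full tuple is mapped to itself by exchanging
    the coordinates in A. *)
Lemma avg_restrict x0 A (F : tuple_on X A -> R) :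
  avg (fun z => F (restrict A z)) = avg F.
Proof.
have T0 : (0 < #|all_tuples X|)%N by apply/card_gt0P; exists x0.
have U0 : (0 < #|tuple_on X A|)%N by apply/card_gt0P; exists (restrict A x0).
pose h (p : tuple_on X A * all_tuples X) :=
  (restrict A p.2, overwrite p.2 (tuple_set p.1)).
have hK : involutive h.
  move=> [u z]; rewrite /h /=; congr (_, _).
    apply: tuple_set_inj; rewrite tuple_set_restrict.
    exact: proj_overwrite (tuple_set_K _).
  rewrite tuple_set_restrict; apply/ffunP => i; case iA : (i \in A).
    by have /proj_eqP -> := proj_overwrite (overwrite z (tuple_set u)) (proj_K z A).
  rewrite (overwrite_off _ (proj_K z A)) ?iA //.
  by rewrite (overwrite_off _ (tuple_set_K u)) ?iA.
by rewrite -(avg_swap F T0 hK) avg_pair -[LHS](avg_const _ U0).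
Qed.

Lemma avg_mem_proj x0 A (S : {set {set vertex X}}) : S \subset K X A ->
  avg (fun z => (proj z A \in S)%:R) = #|S|%:R / #|tuple_on X A|%:R :> R.
Proof.
move=> /subsetP SK.
rewrite (eq_avg (g := fun z => (tuple_set (restrict A z) \in S)%:R)); last first.
  by move=> z; rewrite tuple_set_restrict.
rewrite (avg_restrict x0 (fun u => (tuple_set u \in S)%:R)) /avg mulrC.
congr (_ / _); rewrite -natr_sum; congr (_%:R).
transitivity #|[set u : tuple_on X A | tuple_set u \in S]|.
  rewrite -sum1dep_card [RHS]big_mkcond; apply: eq_bigr => u _.
  by case: (_ \in S).
rewrite -(card_imset _ (@tuple_set_inj A)); apply: eq_card => B.
apply/imsetP/idP => [[u]|BS]; first by rewrite inE => uS ->.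
have [z Bz] := K_proj x0 (SK _ BS).
by exists (restrict A z); rewrite ?inE tuple_set_restrict -?Bz.
Qed.

End Projections.

Section ChainsOfColourings.

Variables (r : nat) (X : 'I_r -> finType) (k : nat).
Variables (q : {set 'I_r} -> all_tuples X -> nat).
Variables (Q : {set 'I_r} -> {set {set {set vertex X}}}).
Implicit Types (A C : {set 'I_r}) (x y z : all_tuples X) (B S : {set vertex X}).

Hypothesis aq : adapted q.
Hypothesis Qq : forall A x y, (#|A| <= k)%N ->
  C_equiv Q A (proj x A) (proj y A) = (q A x == q A y).
Variable x0 : all_tuples X.

Lemma C_equiv_proj A C x y : (#|A| <= k)%N -> C \subset A ->
  C_equiv Q C (proj x A) (proj y A) = (q C x == q C y).
Proof.
move=> Ak CA; have Ck : (#|C| <= k)%N by apply: leq_trans (subset_leq_card CA) Ak.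
by rewrite -(Qq x y Ck) /C_equiv !subidx_proj.
Qed.

Lemma strong_equiv_proj A x y : (#|A| <= k)%N ->
  strong_equiv Q A (proj x A) (proj y A) =
  [forall (C : {set 'I_r} | C \subset A), q C x == q C y].
Proof.
move=> Ak; apply: eq_forallb => C; case CA : (C \subset A) => //=.
by rewrite C_equiv_proj.
Qed.

Lemma chain_at_proj A x z :
  (proj z A \in chain_at k Q x) =
  (#|A| <= k)%N && [forall (C : {set 'I_r} | C \subset A), q C z == q C x].
Proof.
apply/bigcupP/andP => [[A' A'k]|[Ak H]]; last first.
  by exists A => //; rewrite inE proj_K strong_equiv_proj.
rewrite inE => /andP[/K_idx]; rewrite idx_proj => AA'.
by rewrite -AA' in A'k *; rewrite strong_equiv_proj.
Qed.

Lemma chain_at_K x B : B \in chain_at k Q x ->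
  exists z, B = proj z (idx B) /\ (#|idx B| <= k)%N.
Proof.
case/bigcupP => A Ak; rewrite inE => /andP[BK _].
by have [z Bz] := K_proj x0 BK; exists z; rewrite (K_idx BK).
Qed.

Lemma Hidx_proj A x z : (#|A| <= k)%N ->
  (proj z A \in Hidx (chain_at k Q x) A) = (q A z == q A x) && in_cell q x A z.
Proof.
move=> Ak; rewrite inE idx_proj eqxx andbT chain_at_proj Ak /= /in_cell.
rewrite lower_key_eqE; apply/forall_inP/andP => [H|[H1 /forall_inP H2] C].
  split; first exact: H.
  by apply/forall_inP => C /proper_sub; apply: H.
by rewrite subEproper => /orP[/eqP ->|/H2].
Qed.

Lemma Hstar_proj A x z : (#|A| <= k)%N ->
  (proj z A \in Hstar (chain_at k Q x) A) = in_cell q x A z.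
Proof.
move=> Ak; rewrite inE proj_K /= /in_cell lower_key_eqE.
apply/forallP/forall_inP => [H C CA|H S].
  case/properP: (CA) => CA' [i iA iC].
  have := H (proj z (A :\ i)); rewrite proj_sub ?subsetDl // !card_proj.
  rewrite [#|A|](cardsD1 i) iA eqxx /= chain_at_proj => /andP[_ /forall_inP].
  by apply; rewrite subsetD1 CA' iC.
apply/implyP => /andP[/sub_proj[-> SA]]; rewrite idx_proj in SA *; rewrite !card_proj => /eqP cS.
rewrite chain_at_proj; apply/andP; split; first by rewrite ltnW // cS.
apply/forall_inP => C CS; apply: H; rewrite properEcard (subset_trans CS SA) /=.
by rewrite -cS ltnS subset_leq_card.
Qed.

Lemma is_kchain_chain_at x : (k <= r)%N -> is_kchain k (chain_at k Q x).
Proof.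
move=> kr; split.
- split=> [B /chain_at_K[z [-> _]] i|B B' BH B'B].
    by rewrite proj_part; case: ifP; rewrite ?cards1 ?cards0.
  have [z [Bz Bk]] := chain_at_K BH.
  move: BH B'B; rewrite {}Bz chain_at_proj => /andP[_ /forall_inP H].
  case/sub_proj => BE sub; rewrite BE chain_at_proj.
  rewrite (leq_trans (subset_leq_card sub)) //=.
  by apply/forall_inP => C /subset_trans/(_ sub); apply: H.
- pose A := [set widen_ord kr i | i : 'I_k].
  have Ak : #|A| = k.
    rewrite card_imset ?card_ord // => i j /(congr1 val) /= ij.
    exact: val_inj.
  exists (proj x A); last by rewrite card_proj.
  by rewrite chain_at_proj Ak leqnn; apply/forall_inP => C _; rewrite eqxx.
- by move=> B /chain_at_K[z [BE Bk]]; rewrite BE card_proj.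
Qed.

Lemma eq_chain_at x y :
  (forall A, (#|A| <= k)%N -> q A x = q A y) -> chain_at k Q x = chain_at k Q y.
Proof.
move=> xy; have sub x' y' : (forall A, (#|A| <= k)%N -> q A x' = q A y') ->
    chain_at k Q x' \subset chain_at k Q y'.
  move=> E; apply/subsetP => B BH; have [z [Bz _]] := chain_at_K BH.
  move: BH; rewrite Bz !chain_at_proj => /andP[Bk /forall_inP H].
  rewrite Bk; apply/forall_inP => C CB; rewrite -E ?H //.
  exact: leq_trans (subset_leq_card CB) Bk.
by apply/eqP; rewrite eqEsubset !sub // => A /xy.
Qed.

Lemma chain_at_decomposition : (k <= r)%N ->
  is_chain_decomposition k [set chain_at k Q x | x : all_tuples X].
Proof.
move=> kr; split.
- by move=> H /imsetP[x _ ->]; apply: is_kchain_chain_at.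
- move=> H H' /imsetP[x _ ->] /imsetP[y _ ->] A Ak.
  have HidxE x' B : B \in Hidx (chain_at k Q x') A -> exists z, B = proj z A.
    rewrite inE => /andP[/chain_at_K[z [Bz _]] /eqP BA].
    by exists z; rewrite -BA.
  have HE x' z : (proj z A \in Hidx (chain_at k Q x') A) =
      [forall (C : {set 'I_r} | C \subset A), q C z == q C x'].
    by rewrite inE idx_proj eqxx andbT chain_at_proj Ak.
  case: (boolP [forall (C : {set 'I_r} | C \subset A), q C x == q C y]).
    move=> /forall_inP xy; left; apply/setP => B.
    apply/idP/idP => BH; have [z Bz] := HidxE _ _ BH; move: BH; rewrite Bz !HE;
      move=> /forall_inP E; apply/forall_inP => C CA; rewrite (eqP (E C CA)).
      exact: xy.
    by rewrite eq_sym xy.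
  move=> nxy; right; rewrite -setI_eq0; apply/eqP/setP => B; rewrite in_set0.
  apply/negP => /setIP[BH BH']; have [z Bz] := HidxE _ _ BH.
  move: BH BH'; rewrite Bz !HE => /forall_inP E /forall_inP E'.
  case/negP: nxy; apply/forall_inP => C CA.
  by rewrite -(eqP (E C CA)) E'.
- move=> x; exists (chain_at k Q x); split.
    split; first exact: imset_f.
    move=> S /sub_proj[-> _]; rewrite card_proj => Sk.
    by rewrite chain_at_proj Sk; apply/forall_inP => C _; rewrite eqxx.
  move=> H [/imsetP[y _ ->] Hx]; apply: eq_chain_at => A Ak.
  have := Hx (proj x A); rewrite proj_sub ?subsetT // card_proj chain_at_proj.
  by move=> /(_ isT Ak)/andP[_ /forall_inP/(_ A (subxx A))/eqP].
Qed.

Section Densities.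

Variable R : realType.

Lemma reldens_chain_at A x : (#|A| <= k)%N ->
  reldens R (chain_at k Q x) A = density R q x A.
Proof.
move=> Ak; have U0 : (#|tuple_on X A|%:R : R) != 0.
  by rewrite pnatr_eq0 -lt0n; apply/card_gt0P; exists (restrict A x0).
have T0 : (#|all_tuples X|%:R : R) != 0.
  by rewrite pnatr_eq0 -lt0n; apply/card_gt0P; exists x0.
have sI : Hidx (chain_at k Q x) A \subset K X A.
  apply/subsetP => B; rewrite inE => /andP[/chain_at_K[z [Bz _]] /eqP BA].
  by rewrite Bz BA proj_K.
have sS : Hstar (chain_at k Q x) A \subset K X A.
  by apply/subsetP => B; rewrite inE => /andP[].
have div_avg (a b c : R) : c != 0 -> (a / c) / (b / c) = a / b.
  by move=> c0; rewrite invfM invrK [b^-1 * c]mulrC mulrA divfK.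
rewrite /reldens -(div_avg _ _ _ U0) -!(avg_mem_proj R x0) //.
rewrite (eq_avg (fun z => congr1 (fun b : bool => b%:R) (Hidx_proj x z Ak))).
rewrite (eq_avg (fun z => congr1 (fun b : bool => b%:R) (Hstar_proj x z Ak))).
rewrite /density /local_density /cexp /avg ![(_)^-1 * _]mulrC div_avg //.
congr (_ / _).
  rewrite [RHS]big_mkcond /=; apply: eq_bigr => z _.
  by rewrite /colour_ind /in_cell andbC; case: (lower_key _ _ _ == _).
by rewrite -natr_sum -sum1_card [in RHS]big_mkcond /=; congr (_%:R).
Qed.

Lemma balanced_restrict A x z : (#|A| <= k)%N ->
  balanced R (chain_at k Q x) (restrict A z) = balanced_cell R q x A z.
Proof.
move=> Ak; rewrite /balanced tuple_set_restrict Hidx_proj // Hstar_proj //.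
rewrite reldens_chain_at // /balanced_cell.
by case: (q A z == _); case: (in_cell _ _ _ _); rewrite ?mulr1 ?mulr0 ?sub0r ?subr0 ?oppr0.
Qed.

(** A corner of the octahedron, given by a function from A to bool, is turned
    into an edge on the index set bool. *)
Lemma oct_restrict A (F : tuple_on X A -> R) x :
  Oct F = avg (fun y : {ffun bool -> all_tuples X} =>
    \prod_(e : edge r bool | dom e == A) F (restrict A (place x y e))).
Proof.
pose two (p : all_tuples X * all_tuples X) : {ffun bool -> all_tuples X} :=
  [ffun b : bool => if b then p.2 else p.1].
have two_bij : bijective two.
  exists (fun y : {ffun bool -> all_tuples X} => (y false, y true)); first by case=> y y'; rewrite !ffunE.
  by move=> y; apply/ffunP => -[]; rewrite ffunE.
rewrite (avg_bij _ two_bij) /Oct !avg_pair.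
rewrite -(avg_restrict x0); apply: eq_avg => y.
rewrite -(avg_restrict x0); apply: eq_avg => y'.
pose h (e : {ffun {i : 'I_r | i \in A} -> bool}) : edge r bool :=
  [ffun i => omap e (insub i)].
pose h' (e : edge r bool) : {ffun {i : 'I_r | i \in A} -> bool} :=
  [ffun i => odflt false (e (val i))].
rewrite (reindex_onto h h') /=; last first.
  move=> e /eqP eA; apply/ffunP => i; rewrite !ffunE.
  have ei : isSome (e i) = (i \in A) by rewrite -eA inE.
  case: insubP => [j jA ji|iA] /=; last first.
    by move: ei; rewrite (negbTE iA); case: (e i).
  by rewrite ffunE ji; move: ei; rewrite jA; case: (e i).
apply: eq_big => [e|e _].
  apply/esym/andP; split.
    apply/eqP/setP => i; rewrite inE ffunE.
    by case: insubP => [j jA <-|/negbTE] //=; rewrite (valP j).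
  by apply/eqP/ffunP => i; rewrite !ffunE valK.
congr (F _); apply/ffunP => i; rewrite !ffunE valK /= !ffunE.
by case: (e i).
Qed.

Lemma rel_quasirandom_chain_at A x (et : R) : (#|A| <= k)%N ->
  rel_quasirandom (chain_at k Q x) et A =
  (oct_cell R q x A <=
     et * \prod_(C : {set 'I_r} | C \subset A) density R q x C ^+ (2 ^ #|C|)).
Proof.
move=> Ak; rewrite /rel_quasirandom (oct_restrict _ x); congr (_ <= et * _).
  by apply: eq_avg => y; apply: eq_bigr => e _; rewrite balanced_restrict.
apply: eq_bigr => C CA; rewrite reldens_chain_at //.
exact: leq_trans (subset_leq_card CA) Ak.
Qed.

End Densities.

End ChainsOfColourings.

(** * Typical points and thresholds *)

Section GoodPoints.

Variables (R : realType) (r : nat) (X : 'I_r -> finType).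
Variables (q : {set 'I_r} -> all_tuples X -> nat).
Implicit Types (A C : {set 'I_r}).

Lemma avg_small_density A (m : nat) (d : R) : 0 <= d ->
  (forall x, (q A x < m)%N) ->
  avg (fun x => (density R q x A < d)%R%:R) <= m%:R * d.
Proof.
move=> d0 qm.
pose h (c : nat) x : R := (local_density R q A c x < d)%R%:R.
apply: (@le_trans _ _ (avg (fun x => \sum_(c < m) h c x * colour_ind R q A c x))).
  apply: avg_le => x; rewrite (bigD1 (Ordinal (qm x))) //= /colour_ind eqxx mulr1.
  by rewrite lerDl sumr_ge0 // => c _; rewrite mulr_ge0 // ler0n.
rewrite avg_sum -[m in leRHS]card_ord mulr_natl -sumr_const; apply: ler_sum => c _.
rewrite -(avg_cexp (key := lower_key q A)); last first.
  by move=> x y xy; rewrite /h /local_density (cexp_key _ xy).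
apply: avg_le_const => // x; rewrite -/(local_density R q A c x) /h.
by case: ltP => [/ltW|_]; rewrite ?mul1r ?mul0r.
Qed.

(** Cells of small relative density cover few points since there are at most m
    of them over each lower cell; a large conditional mean-square error is
    excluded by Markov's inequality. *)
Lemma good_at_mostly A (m : nat) (d eta : nat -> R) (gamma e theta : R) :
  (forall x, (q A x < m)%N) -> level_regular #|A| m e theta q ->
  0 <= d #|A| -> m%:R * d #|A| <= gamma ->
  0 < eta #|A| -> m%:R * e <= eta #|A| * gamma ->
  exists bad : all_tuples X -> R,
    [/\ forall x, 0 <= bad x, avg bad <= 2 * gamma &
        forall x, bad x < 1 -> good_at q x d eta theta A].
Proof.
move=> qm reg d0 dm eta0 em.
have [err Herr] := choice (fun c => reg A c erefl).
pose err2 c x := cexp (lower_key q A) (fun z => err c z ^+ 2) x.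
exists (fun x => (density R q x A < d #|A|)%R%:R +
         \sum_(c < m) (eta #|A| < err2 c x)%R%:R).
split=> [x||x].
- by rewrite addr_ge0 ?ler0n // sumr_ge0 // => c _; rewrite ler0n.
- rewrite avgD avg_sum mulr_natl mulr2n; apply: lerD.
    exact: le_trans (avg_small_density d0 qm) dm.
  apply: (@le_trans _ _ (\sum_(c < m) e / eta #|A|)).
    apply: ler_sum => c _; have [unf [_ _ _ He _]] := Herr c.
    have err2_ge0 x : 0 <= err2 c x by apply: cexp_ge0 => z; apply: sqr_ge0.
    apply: le_trans (markov_avg eta0 err2_ge0) _.
    by rewrite ler_pM2r ?invr_gt0 // avg_cexp1.
  by rewrite sumr_const card_ord -mulr_natl mulrA ler_pdivrMr // mulrC [leRHS]mulrC mulrC.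
have nat_lt1 (b : bool) (a : R) : 0 <= a -> b%:R + a < 1 -> b = false.
  by case: b => // a0; rewrite gtrDl ltNge a0.
move=> H; split.
  rewrite leNgt; apply/negbT; apply: nat_lt1 H.
  by apply: sumr_ge0 => c _; rewrite ler0n.
have [unf [He Hu split_q _ Hunf]] := Herr (Ordinal (qm x)).
exists (err (Ordinal (qm x))), unf; split=> //.
rewrite leNgt; apply/negbT.
rewrite (bigD1 (Ordinal (qm x))) //= addrCA in H.
apply: nat_lt1 H; rewrite addr_ge0 ?ler0n //.
by apply: sumr_ge0 => c _; rewrite ler0n.
Qed.

End GoodPoints.

Section Thresholds.

Variables (R : realType) (k cJ : nat) (eps : R).
Hypothesis cJ_gt0 : (0 < cJ)%N.
Hypotheses (eps_gt0 : 0 < eps) (eps_le1 : eps <= 1).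

(** The recursion for the parameters of quasirandomness, with each relative
    density replaced by a lower bound d and cJ in the place of the number of
    edges of J. *)
Fixpoint eps_low (d : R) (t : nat) : R :=
  if t is t'.+1 then
    2 ^- (t * k + 1) * cJ%:R^-1 * (eps_low d t' * d ^+ cJ) ^+ (2 ^ (t * k))
  else eps.

Definition eta_low (d : R) (t : nat) : R :=
  2^-1 * (eps_low d t * d ^+ cJ) ^+ (2 ^ (k * (t + 1))).

Lemma eps_low_bounds d t : 0 < d <= 1 -> 0 < eps_low d t <= 1.
Proof.
move=> /andP[d0 d1]; elim: t => [|t /andP[IH0 IH1]] /=.
  by rewrite eps_gt0 eps_le1.
have dJ0 : 0 < d ^+ cJ by apply: exprn_gt0.
have dJ1 : d ^+ cJ <= 1 by rewrite exprn_ile1 // ltW.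
apply/andP; split.
  rewrite !mulr_gt0 ?invr_gt0 ?exprn_gt0 ?ltr0n //.
  by rewrite mulr_gt0.
rewrite mulr_ile1 ?mulr_ge0 ?invr_ge0 ?exprn_ge0 ?mulr_ge0 ?ler0n ?(ltW IH0) ?(ltW dJ0) //.
  rewrite mulr_ile1 ?invr_ge0 ?exprn_ge0 ?ler0n // invf_le1 ?exprn_gt0 ?ltr0n //.
    by rewrite exprn_ege1 // ler1n.
  by rewrite ler1n.
by rewrite exprn_ile1 ?mulr_ge0 ?mulr_ile1 ?(ltW IH0) ?(ltW dJ0).
Qed.

Lemma eta_low_bounds d t : 0 < d <= 1 -> 0 < eta_low d t <= 1.
Proof.
move=> d01; have /andP[e0 e1] := eps_low_bounds t d01.
case/andP: d01 => d0 d1.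
have dJ0 : 0 < d ^+ cJ by apply: exprn_gt0.
have dJ1 : d ^+ cJ <= 1 by rewrite exprn_ile1 // ltW.
apply/andP; split; first by rewrite mulr_gt0 ?invr_gt0 ?ltr0n // exprn_gt0 // mulr_gt0.
rewrite mulr_ile1 ?invr_ge0 ?ler0n ?exprn_ge0 ?mulr_ge0 ?(ltW e0) ?(ltW dJ0) //.
  by rewrite invf_le1 ?ltr0n // ler1n.
by rewrite exprn_ile1 ?mulr_ge0 ?mulr_ile1 ?(ltW e0) ?(ltW dJ0).
Qed.

Lemma eps_low_mono d d' t : 0 < d -> d <= d' -> eps_low d t <= eps_low d' t.
Proof.
move=> d0 dd'; have pos u : 0 < u -> forall t, 0 < eps_low u t.
  move=> u0; elim=> [|s IH] //=.
  by rewrite !mulr_gt0 ?invr_gt0 ?exprn_gt0 ?ltr0n // mulr_gt0 // exprn_gt0.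
have d'0 : 0 < d' by apply: lt_le_trans d0 dd'.
elim: t => [|t IH] //=.
rewrite ler_pM2l ?mulr_gt0 ?invr_gt0 ?exprn_gt0 ?ltr0n //.
rewrite lerXn2r ?nnegrE ?mulr_ge0 ?exprn_ge0 ?(ltW (pos _ _ _)) ?(ltW d0) ?(ltW d'0) //.
apply: ler_pM => //; rewrite ?exprn_ge0 ?(ltW (pos _ _ _)) ?(ltW d0) //.
by rewrite lerXn2r ?nnegrE ?(ltW d0) ?(ltW d'0).
Qed.

Lemma eta_low_mono d d' t : 0 < d -> d <= d' <= 1 -> eta_low d t <= eta_low d' t.
Proof.
move=> d0 /andP[dd' d'1].
have d'0 : 0 < d' by apply: lt_le_trans d0 dd'.
have /andP[e0 _] : 0 < eps_low d t <= 1.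
  by rewrite eps_low_bounds // d0 (le_trans dd').
have /andP[e'0 _] : 0 < eps_low d' t <= 1 by rewrite eps_low_bounds // d'0.
rewrite ler_pM2l ?invr_gt0 ?ltr0n //.
rewrite lerXn2r ?nnegrE ?mulr_ge0 ?exprn_ge0 ?(ltW e0) ?(ltW e'0) ?(ltW d0) ?(ltW d'0) //.
apply: ler_pM => //; rewrite ?exprn_ge0 ?(ltW e0) ?(ltW d0) ?eps_low_mono //.
by rewrite lerXn2r ?nnegrE ?(ltW d0) ?(ltW d'0).
Qed.

(** A common lower bound for the thresholds of all levels. *)
Definition eta_all (d : R) : R := \prod_(t < k.+1) eta_low d t.

Lemma eta_all_bounds d : 0 < d <= 1 -> 0 < eta_all d <= 1.
Proof.
move=> d01; apply/andP; split.
  by apply: prodr_gt0 => t _; have /andP[] := eta_low_bounds t d01.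
by apply: prodr_ile1 => t _; have /andP[/ltW -> ->] := eta_low_bounds t d01.
Qed.

Lemma eta_all_mono d d' : 0 < d -> d <= d' <= 1 -> eta_all d <= eta_all d'.
Proof.
move=> d0 dd'; have d01 : 0 < d <= 1.
  by case/andP: dd' => dd' d'1; rewrite d0 (le_trans dd').
apply: ler_prod => t _; rewrite eta_low_mono // andbT.
by have /andP[/ltW] := eta_low_bounds t d01.
Qed.

Lemma eta_all_le d t : 0 < d <= 1 -> (t <= k)%N -> eta_all d <= eta_low d t.
Proof.
move=> d01 tk; rewrite /eta_all (bigD1 (Ordinal (tk : (t < k.+1)%N))) //=.
have /andP[/ltW e0 _] := eta_low_bounds t d01.
rewrite ler_piMr //; apply: prodr_ile1 => s _.
by have /andP[/ltW -> ->] := eta_low_bounds s d01.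
Qed.

End Thresholds.

Section ThresholdsOfChains.

Variables (R : realType) (r : nat) (X : 'I_r -> finType).
Variables (H : {set {set vertex X}}) (E : 'I_r -> finType).
Variables (J : {set {set vertex E}}) (k : nat) (eps d : R) (j : nat).
Hypothesis J_gt0 : (0 < #|J|)%N.
Hypotheses (eps_gt0 : 0 < eps) (eps_le1 : eps <= 1) (d01 : 0 < d <= 1).
Hypothesis dense : forall A, A \in J -> (j <= #|A|)%N -> d <= reldens R H (idx A).

Lemma dens_prod_ge m : (j <= m)%N -> d ^+ #|J| <= dens_prod R H J m.
Proof.
case/andP: d01 => d0 d1 jm; rewrite /dens_prod.
rewrite (eq_bigl (fun A => A \in [set A in J | (m <= #|A|)%N])); last first.
  by move=> A; rewrite inE.
apply: le_trans (prodr_ge_exp (c := d) _ _).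
- rewrite ler_wiXn2l ?(ltW d0) //; apply: subset_leq_card.
  by apply/subsetP => A; rewrite inE => /andP[].
- exact: ltW.
- by move=> A; rewrite inE => /andP[AJ mA]; apply: dense => //; apply: leq_trans jm mA.
Qed.

Lemma eps_desc_ge t : (j <= k - t.-1)%N ->
  eps_low k #|J| eps d t <= eps_desc H J k eps t.
Proof.
case/andP: (d01) => d0 d1; elim: t => [|t IH] //= jt.
have e0 : 0 < eps_low k #|J| eps d t.
  by have /andP[] := eps_low_bounds k J_gt0 eps_gt0 eps_le1 t d01.
have dJ0 : 0 < d ^+ #|J| by apply: exprn_gt0.
rewrite ler_pM2l; last by rewrite mulr_gt0 ?invr_gt0 ?exprn_gt0 ?ltr0n.
have le : eps_low k #|J| eps d t * d ^+ #|J| <=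
    eps_desc H J k eps t * dens_prod R H J (k - t).
  apply: ler_pM; rewrite ?(ltW e0) ?(ltW dJ0) ?dens_prod_ge //.
  by apply: IH; apply: leq_trans jt _; apply: leq_sub2l; apply: leq_pred.
have ge0 := mulr_ge0 (ltW e0) (ltW dJ0).
by apply: lerXn2r => //; rewrite nnegrE // (le_trans ge0).
Qed.

Lemma eta_desc_ge t : (j <= k - t)%N ->
  eta_low k #|J| eps d t <= eta_desc H J k eps t.
Proof.
case/andP: (d01) => d0 d1 jt.
have e0 : 0 < eps_low k #|J| eps d t.
  by have /andP[] := eps_low_bounds k J_gt0 eps_gt0 eps_le1 t d01.
have dJ0 : 0 < d ^+ #|J| by apply: exprn_gt0.
rewrite ler_pM2l ?invr_gt0 ?ltr0n //.
have le : eps_low k #|J| eps d t * d ^+ #|J| <=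
    eps_desc H J k eps t * dens_prod R H J (k - t).
  apply: ler_pM; rewrite ?(ltW e0) ?(ltW dJ0) ?dens_prod_ge //.
  by apply: eps_desc_ge; apply: leq_trans jt _; apply: leq_sub2l; apply: leq_pred.
have ge0 := mulr_ge0 (ltW e0) (ltW dJ0).
by apply: lerXn2r => //; rewrite nnegrE // (le_trans ge0).
Qed.

End ThresholdsOfChains.

(** * Partitions, colourings and the theorem *)

Section ColouringsAndPartitions.

Variables (r : nat) (X : 'I_r -> finType) (k : nat).
Implicit Types (A C : {set 'I_r}) (x y z : all_tuples X).

Section ColouringOfPartition.

Variable P : {set 'I_r} -> {set {set {set vertex X}}}.
Hypothesis partP : forall A, (#|A| <= k)%N -> partition (P A) (K X A).

Definition partition_colour A x : nat :=
  if (#|A| <= k)%N then index (pblock (P A) (proj x A)) (enum (P A)) else 0%N.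

Lemma partition_colour_adapted : adapted partition_colour.
Proof.
by move=> A x y /proj_eqP E; rewrite /partition_colour E.
Qed.

Lemma partition_colour_eq A x y : (#|A| <= k)%N ->
  (partition_colour A x == partition_colour A y) =
  (proj y A \in pblock (P A) (proj x A)).
Proof.
move=> Ak; have partPA := partP Ak; rewrite /partition_colour Ak.
have in_cover z : proj z A \in cover (P A).
  by rewrite (cover_partition partPA) proj_K.
rewrite -eq_pblock ?(partition_trivIset partPA) //.
apply/eqP/eqP => [|-> //].
have in_enum z : pblock (P A) (proj z A) \in enum (P A).
  by rewrite mem_enum pblock_mem.
by move=> E; rewrite -(nth_index set0 (in_enum x)) E nth_index.
Qed.

End ColouringOfPartition.

Section PartitionOfColouring.

Variables (q : {set 'I_r} -> all_tuples X -> nat) (x0 : all_tuples X).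
Hypothesis aq : adapted q.

(** The colour of a set is read off any tuple that projects onto it. *)
Definition set_colour A (B : {set vertex X}) : nat := q A (overwrite x0 B).

Definition colour_partition A : {set {set {set vertex X}}} :=
  preim_partition (set_colour A) (K X A).

Lemma set_colour_proj A x : set_colour A (proj x A) = q A x.
Proof. by apply: aq; apply/proj_eqP; apply: proj_overwrite (proj_K _ _). Qed.

Lemma colour_partitionP A : partition (colour_partition A) (K X A).
Proof. exact: preim_partitionP. Qed.

Lemma colour_partition_cell A (S : {set {set vertex X}}) :
  S \in colour_partition A -> exists z, forall x,
    (proj x A \in S) = (q A x == q A z).
Proof.
case/imsetP => B BK ->; have [z Bz] := K_proj x0 BK.
exists z => x; rewrite inE proj_K set_colour_proj Bz set_colour_proj.
exact: eq_sym.
Qed.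

Lemma C_equiv_colour_partition A x y :
  C_equiv colour_partition A (proj x A) (proj y A) = (q A x == q A y).
Proof.
rewrite /C_equiv !subidx_proj //; apply/exists_inP/eqP => [[S SQ /andP[]]|xy].
  have [z Sz] := colour_partition_cell SQ.
  by rewrite !Sz => /eqP -> /eqP.
exists [set B in K X A | set_colour A (proj x A) == set_colour A B].
  by apply: imset_f; apply: proj_K.
have in_cell z : q A z = q A x -> proj z A \in
    [set B in K X A | set_colour A (proj x A) == set_colour A B].
  by move=> zx; rewrite inE proj_K !set_colour_proj zx eqxx.
by rewrite !in_cell.
Qed.

Lemma card_colour_partition A (m : nat) :
  (forall x, (q A x < m)%N) -> (#|colour_partition A| <= m)%N.
Proof.
move=> qm.
have sub : colour_partition A \subset
    [set [set B in K X A | val c == set_colour A B] | c : 'I_m].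
  apply/subsetP => S /imsetP[B BK ->]; apply/imsetP.
  by exists (Ordinal (qm (overwrite x0 B))).
apply: leq_trans (subset_leq_card sub) _.
by apply: leq_trans (leq_imset_card _ _) _; rewrite card_ord.
Qed.

Variable P : {set 'I_r} -> {set {set {set vertex X}}}.
Hypothesis partP : forall A, (#|A| <= k)%N -> partition (P A) (K X A).

Lemma colour_partition_refines A : (#|A| <= k)%N ->
  finer q (partition_colour P) -> refines (colour_partition A) (P A).
Proof.
move=> Ak fin S SQ; have [z Sz] := colour_partition_cell SQ.
exists (pblock (P A) (proj z A)).
  by rewrite pblock_mem // (cover_partition (partP Ak)) proj_K.
apply/subsetP => B BS.
have BK : B \in K X A.
  rewrite -(cover_partition (colour_partitionP A)); apply/bigcupP; by exists S.
have [x Bx] := K_proj x0 BK; move: BS; rewrite Bx Sz => /eqP/fin E.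
by rewrite -partition_colour_eq // E.
Qed.

Lemma colour_partition_id A : (#|A| <= k)%N ->
  q A = partition_colour P A -> colour_partition A = P A.
Proof.
move=> Ak qA; rewrite -[RHS](equivalence_partition_pblock (partP Ak)).
apply: eq_in_imset => B BK; apply/setP => B'; rewrite in_set [RHS]in_set.
case B'K : (B' \in K X A) => //=.
have [x ->] := K_proj x0 BK; have [y ->] := K_proj x0 B'K.
by rewrite !set_colour_proj qA partition_colour_eq.
Qed.

End PartitionOfColouring.

End ColouringsAndPartitions.

Lemma card_idx_edge r (E : 'I_r -> finType) (J : {set {set vertex E}}) A :
  is_chain J -> A \in J -> #|idx A| = #|A|.
Proof.
move=> [partJ _] AJ; apply: card_in_imset => v w vA wA vw.
have /card_le1_eqP := partJ A AJ (tag v).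
by apply; rewrite !inE ?vA ?wA ?vw eqxx.
Qed.

(** At a point where all relative densities are bounded below and all levels
    decompose well, the octahedral bound applies to every edge of J. *)
Lemma quasirandom_of_good (R : realType) (r k : nat) (E : 'I_r -> finType)
    (J : {set {set vertex E}}) (eps : R) (X : 'I_r -> finType)
    (q : {set 'I_r} -> all_tuples X -> nat)
    (Q : {set 'I_r} -> {set {set {set vertex X}}}) (x : all_tuples X)
    (d eta : nat -> R) (dmin theta : R) (B : nat) :
  is_kchain k J -> 0 < eps <= 1 -> adapted q ->
  (forall (A : {set 'I_r}) y z, (#|A| <= k)%N ->
     C_equiv Q A (proj y A) (proj z A) = (q A y == q A z)) ->
  0 < dmin -> (forall i, (i <= k)%N -> dmin <= d i <= 1) ->
  (forall i i', (i <= i')%N -> d i <= d i') ->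
  (3 ^ r * 2 ^ k.+1 <= B)%N ->
  (forall i, (i <= k)%N ->
     0 <= eta i <= eta_all k #|J| eps (d i) ^+ 2 * (d i / 4) ^+ (4 * B)) ->
  0 <= theta <= eta_all k #|J| eps dmin * (dmin / 2) ^+ B / 2 ->
  (forall A : {set 'I_r}, (#|A| <= k)%N -> good_at q x d eta theta A) ->
  quasirandom (chain_at k Q x) J k eps.
Proof.
move=> [chJ [A0 A0J A0k] Jk] /andP[eps0 eps1] aq Qq dmin0 dB dmono BB etaB.
move=> /andP[th0 thB] good.
have J0 : (0 < #|J|)%N by apply/card_gt0P; exists A0.
have d01 i : (i <= k)%N -> 0 < d i <= 1.
  by move=> /dB/andP[dm d1]; rewrite d1 (lt_le_trans dmin0).
apply/forall_inP => A AJ; apply/implyP => /andP[_ Ak].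
have iA := card_idx_edge chJ AJ; set j := #|A| in Ak iA *.
have ik : (#|idx A| <= k)%N by rewrite iA.
have eb i : (i <= k)%N -> 0 < eta_all k #|J| eps (d i) <= 1.
  by move=> /d01; apply: eta_all_bounds.
rewrite (rel_quasirandom_chain_at Qq x) //.
have /andP[e0 e1] := eb j Ak.
have /andP[dm dj1] := dB j Ak.
apply: (@le_trans _ _ (eta_all k #|J| eps (d j) *
    \prod_(C : {set 'I_r} | C \subset idx A) density R q x C ^+ (2 ^ #|C|))).
  apply: (oct_cell_le aq (dmin := dmin) (d := d) (eta := eta) (theta := theta)
            (j := j) (B := B)) => //.
  - by move=> C Cj; apply: good; apply: leq_trans (ltnW Cj) Ak.
  - by move=> i ij; apply: dB; apply: leq_trans ij Ak.
  - move=> i /ltnW ij; have ik' := leq_trans ij Ak.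
    have /andP[-> le] := etaB i ik'; apply: (le_trans le).
    have /andP[ei0 ei1] := eb i ik'; have /andP[di0 _] := d01 i ik'.
    by rewrite ler_piMl ?exprn_ge0 ?divr_ge0 ?(ltW di0) // exprn_ile1 // ltW.
  - by apply: leq_trans BB; rewrite leq_mul2l leq_exp2l // ltnS Ak orbT.
  - exact: good.
  - by rewrite (ltW e0).
  - exact: etaB.
  - rewrite th0 (le_trans thB) // ler_pM2r ?invr_gt0 ?ltr0n //.
    rewrite ler_wpM2r ?exprn_ge0 ?divr_ge0 ?(ltW dmin0) //.
    by apply: eta_all_mono => //; rewrite dm.
apply: ler_wpM2r.
  by apply: prodr_ge0 => C _; rewrite exprn_ge0 // density_ge0.
apply: le_trans (eta_all_le J0 eps0 eps1 (d01 j Ak) (leq_subr j k)) _.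
apply: (@eta_desc_ge _ _ _ _ _ _ _ _ _ j) => //; first exact: d01.
  move=> A' A'J jA'; have iA' := card_idx_edge chJ A'J.
  rewrite (reldens_chain_at Qq x) ?iA' ?Jk //.
  have [dA' _] : good_at q x d eta theta (idx A') by apply: good; rewrite iA' Jk.
  by apply: le_trans dA'; rewrite iA'; apply: dmono.
by rewrite subKn.
Qed.

Theorem theorem7p3 (R : realType) (r k : nat) (E : 'I_r -> finType)
    (J : {set {set vertex E}}) (eps : R)
    (hJ : is_kchain k J) (eps_gt0 : 0 < eps) (eps_le : eps <= #|J|%:R^-1)
    (n : {set 'I_r} -> nat) :
  exists M : {set 'I_r} -> nat,
  forall (X : 'I_r -> finType) (P : {set 'I_r} -> {set {set {set vertex X}}}),
    (forall A : {set 'I_r}, (#|A| <= k)%N ->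
       partition (P A) (K X A) /\ #|P A| = n A) ->
  exists Q : {set 'I_r} -> {set {set {set vertex X}}},
    (forall A : {set 'I_r}, (#|A| <= k)%N ->
       [/\ partition (Q A) (K X A),
           refines (Q A) (P A),
           #|A| = k -> Q A = P A
         & (#|Q A| <= M A)%N])
    /\ is_chain_decomposition k [set chain_at k Q x | x : all_tuples X]
    /\ ((0 < #|all_tuples X|)%N ->
        1 - eps <= uprob R (fun x : all_tuples X =>
                     quasirandom (chain_at k Q x) J k eps)).
Proof.
have [chJ [A0 A0J A0k] Jk] := hJ.
have J0 : (0 < #|J|)%N by apply/card_gt0P; exists A0.
have eps1 : eps <= 1.
  by apply: le_trans eps_le _; rewrite invf_le1 ?ltr0n // ler1n.
have kr : (k <= r)%N.
  by rewrite -A0k -(card_idx_edge chJ A0J) -[r in leqRHS]card_ord max_card.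
(* There are 2^r index sets, each of them bad with probability at most
   2 * gamma. *)
pose gamma : R := eps / 2 ^+ r.+1.
have gamma0 : 0 < gamma by rewrite divr_gt0 // exprn_gt0.
have gamma1 : gamma <= 1.
  rewrite ler_pdivrMr ?exprn_gt0 // mul1r (le_trans eps1) //.
  by rewrite exprn_ege1 // (ler1n _ 2).
(* The lower bound for the relative densities of a level with m colours. The
   successor makes it positive for m = 0 too. *)
pose dd (m : nat) : R := gamma / m.+1%:R.
have dd0 m : 0 < dd m by rewrite divr_gt0 // ltr0n.
have dd1 m : dd m <= 1.
  by rewrite ler_pdivrMr ?ltr0n // mul1r (le_trans gamma1) // ler1n.
have ddmono m m' : (m <= m')%N -> dd m' <= dd m.
  by move=> mm; rewrite ler_pM2l // lef_pV2 ?posrE ?ltr0n // ler_nat ltnS.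
have ddm m : m%:R * dd m <= gamma.
  rewrite mulrCA ler_piMr ?(ltW gamma0) // ler_pdivrMr ?ltr0n //.
  by rewrite mul1r ler_nat.
pose ea (m : nat) : R := eta_all k #|J| eps (dd m).
have ea0 m : 0 < ea m.
  by have /andP[] := eta_all_bounds k J0 eps_gt0 eps1 (d := dd m)
    (introT andP (conj (dd0 m) (dd1 m))).
(* An octahedron has at most 3^r edges, and its counting goes through at most
   k + 1 successive doublings. *)
pose B := (3 ^ r * 2 ^ k.+1)%N.
pose eta (m : nat) : R := ea m ^+ 2 * (dd m / 4) ^+ (4 * B).
have quarter0 m c : (0 < c)%N -> 0 < dd m / c%:R.
  by move=> c0; rewrite divr_gt0 ?ltr0n.
have eta0 m : 0 < eta m.
  by apply: mulr_gt0; apply: exprn_gt0 => //; apply: quarter0.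
(* With this error, Markov's inequality leaves probability gamma for all the m
   colours together. *)
pose er (m : nat) : R := eta m * dd m.
have er0 m : 0 < er m by rewrite mulr_gt0.
(* The factor 2^B hidden in the denominator pays for the expansion of the other
   corners of an octahedron into test functions. *)
pose th (m : nat) : R := ea m * (dd m / 2) ^+ B / 2.
have th0 m : 0 < th m.
  rewrite divr_gt0 ?ltr0n //; apply: mulr_gt0 => //.
  by apply: exprn_gt0; apply: quarter0.
have [M HM] := strong_regularity r er0 th0 k (\max_(A : {set 'I_r} | (#|A| <= k)%N) n A).+1.
exists (fun A => maxn M (n A)) => X P HP.
have partP (A : {set 'I_r}) : (#|A| <= k)%N -> partition (P A) (K X A) by case/HP.
case: (pickP (all_tuples X)) => [x0 _|empty]; last first.
  exists P; split.
    move=> A Ak; have [PA <-] := HP A Ak; split=> //; last exact: leq_maxr.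
    by move=> S SP; exists S.
  split; last by move=> /card_gt0P[x]; have := empty x.
  by split=> [H /imsetP[x]|H H' /imsetP[x]|x]; have := empty x.
have q0lt (A : {set 'I_r}) x : (partition_colour k P A x < (\max_(A : {set 'I_r} | (#|A| <= k)%N) n A).+1)%N.
  rewrite /partition_colour ltnS; case: ifP => // Ak.
  apply: leq_trans (index_size _ _) _; rewrite -cardE.
  have [_ ->] := HP A Ak.
  exact: (leq_bigmax_cond (P := fun A : {set 'I_r} => (#|A| <= k)%N)).
have [q [ms [[aq fin qk] [msm msk ms0 qms reg]]]] :=
  HM X _ (@partition_colour_adapted r X k P) q0lt.
pose Q := colour_partition q x0.
have Qq (A : {set 'I_r}) y z : (#|A| <= k)%N ->
    C_equiv Q A (proj y A) (proj z A) = (q A y == q A z).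
  by move=> _; apply: C_equiv_colour_partition.
exists Q; split.
  move=> A Ak; split.
  - exact: colour_partitionP.
  - exact: (colour_partition_refines aq partP Ak fin).
  - move=> Ak'; have kA : (k <= #|A|)%N by rewrite Ak'.
    exact: (colour_partition_id x0 aq partP Ak (qk A kA)).
  - apply: leq_trans (leq_maxl _ _); apply: card_colour_partition => x.
    by apply: leq_trans (qms A x) _; apply: leq_trans ms0; apply: msm.
split; first exact: (chain_at_decomposition Qq x0 kr).
move=> T0.
pose d i := dd (ms i).
have mostly (A : {set 'I_r}) : exists bad : all_tuples X -> R, (#|A| <= k)%N ->
    [/\ forall x, 0 <= bad x, avg bad <= 2 * gamma &
        forall x, bad x < 1 -> good_at q x d (fun i => eta (ms i)) (th (ms 0%N)) A].
  case: (leqP #|A| k) => Ak; last by exists (fun=> 0).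
  have [||||||bad Hbad] := @good_at_mostly R r X q A (ms #|A|) d
    (fun i => eta (ms i)) gamma (er (ms #|A|)) (th (ms 0%N)).
  - exact: qms.
  - exact: reg.
  - exact: ltW (dd0 (ms #|A|)).
  - exact: ddm.
  - exact: eta0.
  - rewrite /er mulrCA; apply: ler_wpM2l; first exact: ltW.
    exact: ddm.
  - by exists bad.
have [bad Hbad] := choice mostly.
pose total x := \sum_(A : {set 'I_r} | (#|A| <= k)%N) bad A x.
have bad0 (A : {set 'I_r}) x : (#|A| <= k)%N -> 0 <= bad A x.
  by move=> Ak; have [] := Hbad A Ak.
have avg_total : avg total <= eps.
  rewrite avg_sum; apply: (@le_trans _ _ (\sum_(A : {set 'I_r}) 2 * gamma)).
    rewrite [leLHS]big_mkcond /=; apply: ler_sum => A _; case: ifP => Ak.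
      by have [] := Hbad A Ak.
    by rewrite mulr_ge0 // ltW.
  rewrite sumr_const -cardsT -powersetT card_powerset cardsT card_ord.
  rewrite -[_ *+ (2 ^ r)%N]mulr_natr natrX /gamma exprS.
  rewrite le_eqVlt; apply/orP; left; apply/eqP; field.
  by rewrite expf_neq0 // pnatr_eq0.
apply: (@le_trans _ _ (avg (fun x => 1 - total x))).
  by rewrite avgB avg_const // lerD2l lerN2.
apply: avg_le => x.
have [small|large] := ltP (total x) 1; last first.
  by rewrite (@le_trans _ _ 0) ?subr_le0 ?ler0n.
have -> : quasirandom (chain_at k Q x) J k eps.
  apply: (quasirandom_of_good (q := q) (d := d) (eta := fun i => eta (ms i))
            (dmin := dd (ms 0%N)) (theta := th (ms 0%N)) (B := B)) => //.
  - by rewrite eps_gt0.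
  - by move=> i _; rewrite dd1 andbT; apply: ddmono; apply: msm.
  - by move=> i i' ii'; apply: ddmono; apply: msm.
  - by move=> i _; rewrite lexx andbT ltW.
  - by rewrite lexx andbT ltW.
  - move=> A Ak; have [_ _ Hgood] := Hbad A Ak; apply: Hgood.
    apply: le_lt_trans small; rewrite /total (bigD1 A) //= lerDl.
    by apply: sumr_ge0 => C /andP[Ck _]; apply: bad0.
rewrite lerBlDr lerDl; apply: sumr_ge0 => A; exact: bad0.
Qed.
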